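(* Let $K$ be a field, $E=K\langle e_1,\dots,e_n\rangle$ the exterior algebra, and let $0\neq M\in\mathcal{M}$. A sequence $v_1,\dots,v_s\in E_1$ is an $M$-regular sequence if and only if it is an $M^*$-regular sequence. In particular, $$\operatorname{depth}M=\operatorname{depth}M^*\quad\text{and}\quad \operatorname{cx}M=\operatorname{cx}M^*.$$
   Context: $E$ is standard graded with $\deg e_i=1$. $\mathcal{M}$ is the category of finitely generated graded left and right $E$-modules $M$ with $am=(-1)^{\deg a\deg m}ma$ for homogeneous $a,m$. $M^*=\operatorname{Hom}_E(M,E)$ is the dual of $M$. An element $v\in E_1$ is $M$-regular if $0:_Mv=vM$; a sequence $v_1,\dots,v_s\in E_1$ is $M$-regular if $v_i$ is $M/(v_1,\dots,v_{i-1})M$-regular for each $i$ and $M/(v_1,\dots,v_s)M\neq 0$; $\operatorname{depth}M$ is the common length of all maximal $M$-regular sequences. With $\beta_i(M)=\sum_j\dim_K\operatorname{Tor}^E_i(K,M)_j$, the complexity is $\operatorname{cx}M=\inf\{c\in\mathbb{N}:\exists\alpha\in\mathbb{R},\ \beta_i(M)\leq\alpha i^{c-1}\ \forall i\geq1\}$. *)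

(* Defs.v *)
From HB Require Import structures.
From mathcomp Require Import all_boot all_order all_algebra.
From mathcomp Require Import all_classical all_reals ereal.

Set Implicit Arguments.
Unset Strict Implicit.
Unset Printing Implicit Defensive.

Import Order.TTheory GRing.Theory Num.Theory.

Local Open Scope ring_scope.

Section ExteriorAlgebra.
Variables (K : fieldType) (n : nat).

(* An element of K<e_1, ..., e_n> is the family of its coefficients on the    *)
(* basis e_S = e_{i_1} ... e_{i_k}, S = {i_1 < ... < i_k}.                    *)
Definition extalg := {ffun {set 'I_n} -> K}.

HB.instance Definition _ := GRing.Zmodule.on extalg.
HB.instance Definition _ := GRing.Zmodule_isLmodule.Build K extalg
  (@ffun_scaleA K {set 'I_n} K^o) (@ffun_scale1 K {set 'I_n} K^o)
  (@ffun_scale_addr K {set 'I_n} K^o) (@ffun_scale_addl K {set 'I_n} K^o).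

(* e_S * e_T = (-1) ^ inversions S T * e_(S :|: T) for disjoint S and T.      *)
Definition inversions (S T : {set 'I_n}) : nat :=
  #|[set p : 'I_n * 'I_n | [&& p.1 \in S, p.2 \in T & (p.2 < p.1)%N]]|.

Definition ext_basis (S : {set 'I_n}) : extalg := [ffun T => (T == S)%:R].

Definition ext_one : extalg := ext_basis finset.set0.

Definition ext_mul (a b : extalg) : extalg :=
  [ffun S : {set 'I_n} => \sum_(T : {set 'I_n} | T \subset S)
     (-1) ^+ inversions T (S :\: T) * (a T * b (S :\: T))].

Lemma inversions0s S : inversions finset.set0 S = 0%N.
Proof. by apply/eqP; rewrite /inversions cards_eq0; apply/eqP/setP => p; rewrite !inE. Qed.

Lemma inversionss0 S : inversions S finset.set0 = 0%N.
Proof.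
by apply/eqP; rewrite /inversions cards_eq0; apply/eqP/setP => p; rewrite !inE andbF.
Qed.

Lemma inversionsUl (S T U : {set 'I_n}) : [disjoint S & T] ->
  inversions (S :|: T) U = (inversions S U + inversions T U)%N.
Proof.
move=> dST; rewrite /inversions -[LHS]addn0 -cardsUI; congr (_ + _)%N.
  by apply: eq_card => p; rewrite !inE andb_orl.
symmetry; apply/eqP; rewrite cards_eq0; apply/eqP/setP => p; rewrite !inE.
apply/negP => /andP[/andP[pS _] /andP[pT _]].
by have := disjointFr dST pS; rewrite pT.
Qed.

Lemma inversionsUr (S T U : {set 'I_n}) : [disjoint T & U] ->
  inversions S (T :|: U) = (inversions S T + inversions S U)%N.
Proof.
move=> dTU; rewrite /inversions -[LHS]addn0 -cardsUI; congr (_ + _)%N.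
  apply: eq_card => p; rewrite !inE.
  by case: (_ \in S); case: (_ \in T); case: (_ \in U); case: (_ < _)%N.
symmetry; apply/eqP; rewrite cards_eq0; apply/eqP/setP => p; rewrite !inE.
apply/negP => /andP[/and3P[_ pT _] /and3P[_ pU _]].
by have := disjointFr dTU pT; rewrite pU.
Qed.

Lemma ext_mulA : associative ext_mul.
Proof.
move=> a b c; apply/ffunP => S; rewrite !ffunE.
under eq_bigr => T TS do rewrite ffunE big_distrr big_distrr /=.
under [RHS]eq_bigr => U US do rewrite ffunE big_distrl big_distrr /=.
rewrite [RHS](exchange_big_dep (fun T : {set 'I_n} => T \subset S)) /=; last first.
  by move=> U T US TU; apply: fintype.subset_trans TU US.
apply: eq_bigr => T TS.
rewrite [RHS](reindex_onto (fun V : {set 'I_n} => T :|: V)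
                           (fun U : {set 'I_n} => U :\: T)) /=; last first.
  move=> U /andP[_ TU]; apply/setP => x; rewrite !inE.
  by case: (boolP (x \in T)) => //= /(fintype.subsetP TU) ->.
apply: eq_big => [V|V VST].
  rewrite finset.subsetUl andbT finset.subUset TS /= finset.subsetD.
  case: (V \subset S) => //=; apply/idP/eqP => [dVT|<-].
    apply/setP => x; rewrite !inE.
    case: (boolP (x \in T)) => //= xT.
    by rewrite (disjointFl dVT xT).
  by rewrite finset.disjoints_subset; apply/fintype.subsetP => x; rewrite !inE => /andP[].
have dVT : [disjoint T & V].
  by move: VST; rewrite finset.subsetD disjoint_sym => /andP[].
have VS : V \subset S by move: VST; rewrite finset.subsetD => /andP[].
have -> : (T :|: V) :\: T = V.
  apply/setP => x; rewrite !inE; case: (boolP (x \in T)) => //= xT.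
  by rewrite (disjointFr dVT xT).
have -> : S :\: (T :|: V) = (S :\: T) :\: V.
  by rewrite finset.setDUl || (apply/setP => x; rewrite !inE negb_or; do !case: (_ \in _)).
set W := (S :\: T) :\: V.
have eST : S :\: T = V :|: W.
  apply/setP => x; rewrite !inE.
  case: (boolP (x \in V)) => //= xV.
  by rewrite (disjointFl dVT xV) (fintype.subsetP VS).
have dVW : [disjoint V & W].
  by rewrite finset.disjoints_subset; apply/fintype.subsetP => x xV; rewrite !inE xV.
rewrite eST inversionsUr // inversionsUl // !exprD.
set x := (-1) ^+ _; set y := (-1) ^+ _; set z := (-1) ^+ _.
rewrite [a T * _]mulrCA !mulrA; do 3!congr (_ * _).
by rewrite -mulrA mulrC.
Qed.

Lemma ext_mul1l : left_id ext_one ext_mul.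
Proof.
move=> a; apply/ffunP => S; rewrite ffunE (bigD1 finset.set0) ?finset.sub0set //=.
rewrite finset.setD0 inversions0s expr0 !mul1r ffunE eqxx mul1r big1 ?addr0 //.
by move=> T /andP[_ /negPf T0]; rewrite ffunE T0 mul0r mulr0.
Qed.

Lemma ext_mul1r : right_id ext_one ext_mul.
Proof.
move=> a; apply/ffunP => S; rewrite ffunE (bigD1 S) //=.
rewrite finset.setDv inversionss0 expr0 mul1r ffunE eqxx mulr1 big1 ?addr0 //.
move=> T /andP[TS TnS]; rewrite ffunE finset.setD_eq0.
have /negPf -> : ~~ (S \subset T); last by rewrite !mulr0.
by apply: contra TnS => ST; rewrite finset.eqEsubset TS.
Qed.

Lemma ext_mulDl : left_distributive ext_mul +%R.
Proof.
move=> a b c; apply/ffunP => S; rewrite !ffunE -big_split /=.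
by apply: eq_bigr => T _; rewrite ffunE mulrDl mulrDr.
Qed.

Lemma ext_mulDr : right_distributive ext_mul +%R.
Proof.
move=> a b c; apply/ffunP => S; rewrite !ffunE -big_split /=.
by apply: eq_bigr => T _; rewrite ffunE !mulrDr.
Qed.

Lemma ext_one_neq0 : ext_one != 0.
Proof.
by apply/eqP => /ffunP/(_ finset.set0)/eqP; rewrite !ffunE eqxx oner_eq0.
Qed.

HB.instance Definition _ := GRing.Zmodule_isNzRing.Build extalg
  ext_mulA ext_mul1l ext_mul1r ext_mulDl ext_mulDr ext_one_neq0.

Lemma ext_mulE (a b : extalg) (S : {set 'I_n}) :
  (a * b) S = \sum_(T : {set 'I_n} | T \subset S)
     (-1) ^+ inversions T (S :\: T) * (a T * b (S :\: T)).
Proof. by rewrite [LHS]ffunE. Qed.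

Lemma ext_scaleE (k : K) (a : extalg) (S : {set 'I_n}) : (k *: a) S = k * a S.
Proof. by rewrite [LHS]ffunE. Qed.

Lemma ext_scalerAl (k : K) (a b : extalg) : k *: (a * b) = k *: a * b.
Proof.
apply/ffunP => S; rewrite ext_scaleE !ext_mulE big_distrr /=.
by apply: eq_bigr => T _; rewrite ext_scaleE -!mulrA mulrCA.
Qed.

HB.instance Definition _ := GRing.Lmodule_isLalgebra.Build K extalg ext_scalerAl.

Lemma ext_scalerAr (k : K) (a b : extalg) : k *: (a * b) = a * (k *: b).
Proof.
apply/ffunP => S; rewrite ext_scaleE !ext_mulE big_distrr /=.
by apply: eq_bigr => T _; rewrite ext_scaleE mulrCA [k * (_ * _)]mulrCA.
Qed.

HB.instance Definition _ := GRing.Lalgebra_isAlgebra.Build K extalg ext_scalerAr.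

Definition ext_gen (i : 'I_n) : extalg := ext_basis [set i].

Lemma ext_genM (i j : 'I_n) : ext_gen i * ext_gen j =
  if i == j then 0 else (-1) ^+ (j < i)%N *: ext_basis [set i; j].
Proof.
apply/ffunP => U; rewrite ext_mulE.
have [iU|iU] := boolP (i \in U); last first.
  rewrite big1 => [|V VU]; last first.
    rewrite !ffunE; have [eV|_] := eqVneq V [set i]; last by rewrite mul0r mulr0.
    by move: VU; rewrite eV finset.sub1set (negPf iU).
  case: ifP => _; first by rewrite ffunE.
  rewrite ext_scaleE ffunE; have [eU|_] := eqVneq U; last by rewrite mulr0.
  by rewrite eU !inE eqxx in iU.
rewrite (bigD1 [set i]) ?finset.sub1set //= big1 ?addr0 => [|V /andP[_ /negPf Vi]]; last first.
  by rewrite !ffunE Vi mul0r mulr0.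
rewrite !ffunE eqxx mul1r.
have [->|ij] := eqVneq i j.
  rewrite ffunE; case: eqP => [/setP/(_ j)|_]; last by rewrite mulr0.
  by rewrite !inE eqxx.
rewrite ext_scaleE ffunE.
have -> : (U :\ i == [set j]) = (U == [set i; j]).
  apply/eqP/eqP => [e|->]; first by rewrite -(finset.setD1K iU) e.
  by rewrite finset.setU1K // inE.
case: eqP => [->|_]; last by rewrite !mulr0.
rewrite finset.setU1K ?inE // !mulr1; congr (_ ^+ _).
have [ji|ji] := boolP (j < i)%N.
  rewrite /inversions (_ : [set _ | _] = [set (i, j)]) ?cards1 //.
  apply/setP => -[x y]; rewrite !inE /= xpair_eqE.
  by case: (x =P i) => //= ->; case: (y =P j) => //= ->; rewrite ji.
apply/eqP; rewrite /inversions cards_eq0; apply/eqP/setP => -[x y]; rewrite !inE /=.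
by case: (x =P i) => [->|_]; case: (y =P j) => [->|_] /=; rewrite ?(negPf ji).
Qed.

Lemma ext_gen_sqr (i : 'I_n) : ext_gen i * ext_gen i = 0.
Proof. by rewrite ext_genM eqxx. Qed.

Lemma ext_gen_anticomm (i j : 'I_n) :
  ext_gen i * ext_gen j = - (ext_gen j * ext_gen i).
Proof.
rewrite !ext_genM eq_sym; have [//|ij] := eqVneq j i; first by rewrite oppr0.
rewrite -scaleNr finset.setUC; congr (_ *: _).
by move: ij; rewrite -val_eqE /=; case: ltngtP => //= _ _; rewrite ?expr0 ?expr1 ?opprK.
Qed.

End ExteriorAlgebra.

Local Open Scope classical_set_scope.
Local Open Scope quotient_scope.

Section Grading.
Variables (K : fieldType) (n : nat).

Definition ext_deg (d : int) : set (extalg K n) :=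
  [set a | forall S : {set 'I_n}, a S != 0 -> #|S|%:Z = d].

End Grading.

Section Quotient.
Variables (R : nzRingType) (M : lmodType R) (s : seq R).

Definition ideal_span : set R :=
  [set a | exists t : seq (R * R * R),
    (forall p, p \in t -> p.1.2 \in s) /\
    a = \sum_(p <- t) p.1.1 * p.1.2 * p.2].

Definition ideal_mod : {pred M} :=
  [pred m | `[< exists t : seq (R * M),
    (forall p, p \in t -> ideal_span p.1) /\
    m = \sum_(p <- t) p.1 *: p.2 >]].

Lemma ideal_span_mull a b : ideal_span b -> ideal_span (a * b).
Proof.
move=> [t [ts ->]]; exists [seq (a * p.1.1, p.1.2, p.2) | p <- t]; split.
  by move=> _ /mapP[p pt ->] /=; apply: ts.
by rewrite big_map big_distrr; apply: eq_bigr => p _ /=; rewrite !mulrA.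
Qed.

Lemma ideal_mod_closed : GRing.subsemimod_closed ideal_mod.
Proof.
split; first split.
- by apply/asboolP; exists [::]; rewrite big_nil.
- move=> x y /asboolP[t [ht ->]] /asboolP[u [hu ->]]; apply/asboolP.
  exists (t ++ u); rewrite big_cat; split=> // p.
  by rewrite mem_cat => /orP[/ht|/hu].
- move=> a x /asboolP[t [ht ->]]; apply/asboolP.
  exists [seq (a * p.1, p.2) | p <- t]; split.
    by move=> _ /mapP[p /ht ? ->]; apply: ideal_span_mull.
  by rewrite big_map scaler_sumr; apply: eq_bigr => p _ /=; rewrite scalerA.
Qed.

HB.instance Definition _ :=
  GRing.isSubmodClosed.Build R M ideal_mod ideal_mod_closed.

(* The module M / (s_1, ..., s_r)M.                                           *)
Definition quotmod := {ideal_quot ideal_mod}.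

HB.instance Definition _ := GRing.Zmodule.on quotmod.

Lemma quot_piD m1 m2 :
  \pi_quotmod (m1 + m2) = \pi_quotmod m1 + \pi_quotmod m2.
Proof. exact: Quotient.pi_add. Qed.

Definition quot_scale (a : R) (x : quotmod) : quotmod :=
  \pi_quotmod (a *: repr x).

Lemma quot_scale_pi a m : quot_scale a (\pi_quotmod m) = \pi_quotmod (a *: m).
Proof.
apply/eqP; rewrite /quot_scale -Quotient.idealrBE -scalerBr.
by apply: rpredZ; rewrite Quotient.idealrBE; apply/eqP; exact: reprK.
Qed.

Lemma quot_scaleA a b x : quot_scale a (quot_scale b x) = quot_scale (a * b) x.
Proof.
elim/quotW: x => m; rewrite [quot_scale b _]quot_scale_pi.
by rewrite !quot_scale_pi scalerA.
Qed.

Lemma quot_scale1 : left_id 1 quot_scale.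
Proof. by move=> x; elim/quotW: x => m; rewrite quot_scale_pi scale1r. Qed.

Lemma quot_scaleDr : right_distributive quot_scale +%R.
Proof.
move=> a x y; elim/quotW: x => x; elim/quotW: y => y.
by rewrite -quot_piD !quot_scale_pi scalerDr quot_piD.
Qed.

Lemma quot_scaleDl x : {morph quot_scale^~ x : a b / a + b}.
Proof.
by move=> a b; elim/quotW: x => x; rewrite !quot_scale_pi scalerDl quot_piD.
Qed.

HB.instance Definition _ := GRing.Zmodule_isLmodule.Build R quotmod
  quot_scaleA quot_scale1 quot_scaleDr quot_scaleDl.

End Quotient.

Section GradedBimodules.
Variables (K : fieldType) (n : nat).
Local Notation E := (extalg K n).

(* The compatibility am.b = a.mb need not be assumed for objects of the       *)
(* category M below, where it follows from the sign rule; it is recorded here *)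
(* because the left action on the dual relies on it.                          *)
Record gbimod := GBimod {
  gb_sort :> lmodType E;
  gb_ract : gb_sort -> E -> gb_sort;
  gb_deg : int -> set gb_sort;
  gb_ractDl : forall a, {morph gb_ract^~ a : x y / x + y};
  gb_ractDr : forall m, {morph gb_ract m : a b / a + b};
  gb_ractA : forall m a b, gb_ract (gb_ract m a) b = gb_ract m (a * b);
  gb_ract1 : forall m, gb_ract m 1 = m;
  gb_lractA : forall a m b, gb_ract (a *: m) b = a *: gb_ract m b
}.

Definition direct_grading (V : zmodType) (D : int -> set V) : Prop :=
  [/\ forall i, D i 0 /\ (forall x y, D i x -> D i y -> D i (x - y)),
      forall x, exists (t : seq int) (c : int -> V),
        (forall i, D i (c i)) /\ x = \sum_(i <- t) c i
    & forall (t : seq int) (c : int -> V), uniq t -> (forall i, D i (c i)) ->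
        \sum_(i <- t) c i = 0 -> forall i, i \in t -> c i = 0].

Definition finitely_generated (M : lmodType E) : Prop :=
  exists (r : nat) (g : 'I_r -> M),
    forall m, exists a : 'I_r -> E, m = \sum_k a k *: g k.

Definition catM (M : gbimod) : Prop :=
  [/\ finitely_generated M,
      direct_grading (@gb_deg M),
      forall i j a (m : M), ext_deg i a -> gb_deg j m -> gb_deg (i + j) (a *: m),
      forall i j a (m : M), ext_deg i a -> gb_deg j m -> gb_deg (j + i) (gb_ract m a)
    & forall i j a (m : M), ext_deg i a -> gb_deg j m ->
        a *: m = (-1) ^+ `|(i * j)%R|%N *: gb_ract m a].

End GradedBimodules.

Section Dual.
Variables (K : fieldType) (n : nat) (M : gbimod K n).
Local Notation E := (extalg K n).

Definition ehom := {linear M -> E^o}.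

HB.instance Definition _ := gen_eqMixin ehom.
HB.instance Definition _ := gen_choiceMixin ehom.

Definition ehom_fun (f : ehom) : M -> E := f.

Lemma ehomP (f g : ehom) : (forall m, ehom_fun f m = ehom_fun g m) -> f = g.
Proof.
rewrite /ehom_fun; case: f g => [f [[f1] [f2]]] [g [[g1] [g2]]] /= /funext fg.
by subst g; rewrite (Prop_irrelevance f1 g1) (Prop_irrelevance f2 g2).
Qed.

Definition ehom_zero : ehom := \0.
Definition ehom_opp (f : ehom) : ehom := \- f.
Definition ehom_add (f g : ehom) : ehom := f \+ g.

Lemma ehom_addA : associative ehom_add.
Proof. by move=> f g h; apply: ehomP => m; apply: addrA. Qed.
Lemma ehom_addC : commutative ehom_add.
Proof. by move=> f g; apply: ehomP => m; apply: addrC. Qed.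
Lemma ehom_add0 : left_id ehom_zero ehom_add.
Proof. by move=> f; apply: ehomP => m; apply: add0r. Qed.
Lemma ehom_addN : left_inverse ehom_zero ehom_opp ehom_add.
Proof. by move=> f; apply: ehomP => m; apply: addNr. Qed.

HB.instance Definition _ :=
  GRing.isZmodule.Build ehom ehom_addA ehom_addC ehom_add0 ehom_addN.

(* (a f)(m) = f(m a) and (f a)(m) = f(m) a                                    *)
Definition lact_fun (a : E) (f : ehom) (m : M) : E^o := ehom_fun f (gb_ract m a).
Definition ract_fun (f : ehom) (a : E) (m : M) : E^o := ehom_fun f m * a.

Lemma lact_linear a f : linear (lact_fun a f).
Proof.
by move=> b x y; rewrite /lact_fun gb_ractDl gb_lractA /ehom_fun linearP.
Qed.

Lemma ract_linear f a : linear (ract_fun f a).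
Proof.
move=> b x y; rewrite /ract_fun /ehom_fun linearP mulrDl; congr (_ + _).
exact/esym/mulrA.
Qed.

HB.instance Definition _ a f :=
  GRing.isLinear.Build E M E^o *:%R (lact_fun a f) (lact_linear a f).
HB.instance Definition _ f a :=
  GRing.isLinear.Build E M E^o *:%R (ract_fun f a) (ract_linear f a).

Definition ehom_lact (a : E) (f : ehom) : ehom := lact_fun a f.
Definition ehom_ract (f : ehom) (a : E) : ehom := ract_fun f a.

Lemma ehom_lactA a b f : ehom_lact a (ehom_lact b f) = ehom_lact (a * b) f.
Proof.
by apply: ehomP => m; congr (ehom_fun f _); apply: gb_ractA.
Qed.
Lemma ehom_lact1 : left_id 1 ehom_lact.
Proof. by move=> f; apply: ehomP => m; congr (ehom_fun f _); apply: gb_ract1. Qed.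
Lemma ehom_lactDr : right_distributive ehom_lact +%R.
Proof. by move=> a f g; apply: ehomP. Qed.
Lemma ehom_lactDl f : {morph ehom_lact^~ f : a b / a + b}.
Proof.
move=> a b; apply: ehomP => m; rewrite /ehom_fun /= /lact_fun gb_ractDr.
exact: (linearD f).
Qed.

HB.instance Definition _ := GRing.Zmodule_isLmodule.Build E ehom
  ehom_lactA ehom_lact1 ehom_lactDr ehom_lactDl.

Lemma ehom_ractDl a : {morph ehom_ract^~ a : f g / f + g}.
Proof. by move=> f g; apply: ehomP => m; apply: mulrDl. Qed.
Lemma ehom_ractDr f : {morph ehom_ract f : a b / a + b}.
Proof. by move=> a b; apply: ehomP => m; apply: mulrDr. Qed.
Lemma ehom_ractA f a b : ehom_ract (ehom_ract f a) b = ehom_ract f (a * b).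
Proof. by apply: ehomP => m; rewrite /ehom_fun /= /ract_fun mulrA. Qed.
Lemma ehom_ract1 f : ehom_ract f 1 = f.
Proof. by apply: ehomP => m; apply: mulr1. Qed.
Lemma ehom_lractA a f b : ehom_ract (a *: f) b = a *: ehom_ract f b.
Proof. exact: ehomP. Qed.

Definition ehom_deg (d : int) : set ehom :=
  [set f | forall i m, gb_deg i m -> ext_deg (i + d) (ehom_fun f m)].

Definition Edual : gbimod K n :=
  GBimod ehom_deg ehom_ractDl ehom_ractDr ehom_ractA ehom_ract1 ehom_lractA.

End Dual.

Section Regular.
Variables (K : fieldType) (n : nat).
Local Notation E := (extalg K n).
Implicit Types (M : lmodType E) (v : E) (s : seq E).

Definition regular_elt M v : Prop :=
  [set m : M | v *: m = 0] = [set v *: m | m in [set: M]].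

Definition regular_seq M s : Prop :=
  [/\ forall v, v \in s -> ext_deg 1 v,
      forall i, (i < size s)%N -> regular_elt (quotmod M (take i s)) s`_i
    & exists x : quotmod M s, x != 0].

Definition maximal_regular_seq M s : Prop :=
  regular_seq M s /\ forall v, ~ regular_seq M (rcons s v).

Definition common_length M (d : nat) : Prop :=
  (exists s, maximal_regular_seq M s) /\
  forall s, maximal_regular_seq M s -> size s = d.

(* None if the maximal regular sequences do not all have the same length,     *)
(* which may happen over a finite field.                                      *)
Definition depth M : option nat :=
  xget None [set Some d | d in common_length M].

End Regular.

Section Betti.
Variables (K : fieldType) (n : nat) (M : gbimod K n).
Local Notation E := (extalg K n).

(* A graded free resolution of M by left modules of finite rank: F_i is       *)
(* 'rV[E]_(res_rank i), its k-th basis vector has degree res_deg i k, and     *)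
(* F_(i+1) -> F_i is right multiplication by res_diff i.                      *)
Record free_resolution := FreeResolution {
  res_rank : nat -> nat;
  res_deg : forall i, 'I_(res_rank i) -> int;
  res_aug : 'I_(res_rank 0) -> M;
  res_diff : forall i, 'M[E]_(res_rank i.+1, res_rank i);
  res_aug_deg : forall k, gb_deg (res_deg k) (res_aug k);
  res_diff_deg : forall i k l,
    ext_deg (res_deg k - res_deg l) (res_diff i k l);
  res_aug_surj : forall m : M,
    exists x : 'rV[E]_(res_rank 0), m = \sum_k x 0 k *: res_aug k;
  res_exact0 : forall x : 'rV[E]_(res_rank 0),
    \sum_k x 0 k *: res_aug k = 0 <-> exists y, x = y *m res_diff 0;
  res_exact : forall i (x : 'rV[E]_(res_rank i.+1)),
    x *m res_diff i = 0 <-> exists y, x = y *m res_diff i.+1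
}.

Variable F : free_resolution.

(* K (x)_E F_i has the K-basis 1 (x) b_k, and a in E acts on the right module *)
(* K = E/(e_1, ..., e_n) through its constant coefficient.                    *)
Definition tensor_diff i : 'M[K]_(res_rank F i.+1, res_rank F i) :=
  \matrix_(k, l) res_diff F i k l finset.set0.

(* The row space of tensor_deg i j is the component (K (x)_E F_i)_j.          *)
Definition tensor_deg i (j : int) : 'M[K]_(res_rank F i) :=
  diag_mx (\row_k (res_deg k == j)%:R).

Definition cycles i (j : int) : 'M[K]_(res_rank F i) :=
  match i with
  | 0 => tensor_deg 0 j
  | i'.+1 => (tensor_deg i'.+1 j :&: kermx (tensor_diff i'))%MS
  end.

Definition boundaries i (j : int) : 'M[K]_(res_rank F i.+1, res_rank F i) :=
  tensor_deg i.+1 j *m tensor_diff i.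

Definition homology_dim i (j : int) : nat :=
  (\rank (cycles i j) - \rank (boundaries i j))%N.

End Betti.

Section Complexity.
Variables (R : realType) (K : fieldType) (n : nat) (M : gbimod K n).

(* dim_K Tor^E_i(K, M)_j                                                      *)
Definition tor_dim (i : nat) (j : int) : nat :=
  xget 0%N [set d | exists F : free_resolution M, d = homology_dim F i j].

Definition betti (i : nat) : nat :=
  \big[addn/0%N]_(j \in [set: int]) tor_dim i j.

Definition complexity : \bar R :=
  ereal_inf [set c%:R%:E | c in [set c : nat | exists alpha : R,
    forall i, (1 <= i)%N -> (betti i)%:R <= alpha * i%:R ^ (c%:Z - 1)]].

End Complexity.

(* Main.v *)
(* In homogeneous coordinates over K, the dual M^* is the transposed representation up to a sign.

   An element v of degree 1 squares to zero on M, so its rank is at most half of dim M, with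
   equality iff v is M-regular.  By induction v_1, ..., v_s is M-regular iff
   2^s rank (v_1 ... v_s) = dim M, a condition which is invariant under transposition.  This gives
   the first claim, and with it the equality of depths.

   For the complexity, the zigzag identity makes M^* a direct summand of M^* (x) M^* (x) M, where E
   acts diagonally.  If F is the minimal free resolution of M, then M^* (x) M^* (x) F is again a
   free resolution, of ranks (dim M)^2 rank F_i.  Hence
   beta_i (M^* ) <= (dim M)^2 beta_i (M), and the converse inequality follows by exchanging the
   roles of M and M^*, so both modules have the same complexity. *)
Require Import Defs.
From HB Require Import structures.
From mathcomp Require Import all_boot all_order all_algebra.
From mathcomp Require Import all_classical all_reals ring.

Set Implicit Arguments.
Unset Strict Implicit.
Unset Printing Implicit Defensive.

Import Order.TTheory GRing.Theory Num.Theory.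
Local Open Scope ring_scope.

(** * The exterior algebra *)

(** The identification of $M^*$ with $\operatorname{Hom}_K(M,K)$ rests on $E$ being a Frobenius
    algebra: an $E$-linear map into $E$ is determined by its top coefficient, and every $K$-linear
    functional arises in this way. The sign comes from the left action $(af)(m)=f(ma)$, where $ma$
    has to be rewritten with $a$ on the left. Over an infinite field the equality of complexities
    would follow from that of depths through $\operatorname{depth}M+\operatorname{cx}M=n$. Over a
    finite field maximal regular sequences may differ in length, so Betti numbers are compared
    directly. The tensor products remain free because the diagonal action on $Q\otimes E^r$ is
    isomorphic to the action on $E^r$ alone, by a map fixing $Q\otimes K^r$. For the rank inequality
    only the resolution of the direct summand has to be minimal: its differentials, and with them
    the homotopy terms, vanish after passing to $K$. *)

Section Exterior.
Variables (K : fieldType) (n : nat).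
Local Notation E := (extalg K n).
Implicit Types (a b v : E) (S T U : {set 'I_n}) (k : K).

Lemma ext_sumE (I : Type) (r : seq I) (P : pred I) (F : I -> E) S :
  (\sum_(i <- r | P i) F i) S = \sum_(i <- r | P i) F i S.
Proof. by apply: (big_morph (fun a : E => a S)) => [a b|]; rewrite ffunE. Qed.

Lemma ext_decomp a : a = \sum_(S : {set 'I_n}) a S *: ext_basis K S.
Proof.
apply/ffunP => U; rewrite ext_sumE (bigD1 U) //= ext_scaleE ffunE eqxx mulr1.
rewrite big1 ?addr0 // => S SU.
by rewrite ext_scaleE ffunE eq_sym (negPf SU) mulr0.
Qed.

Lemma ext_basisM S T : ext_basis K S * ext_basis K T =
  if [disjoint S & T] then (-1) ^+ inversions S T *: ext_basis K (S :|: T) else 0.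
Proof.
apply/ffunP => U; rewrite ext_mulE.
have [SU|nSU] := boolP (S \subset U); last first.
  rewrite big1 => [|V VU]; last first.
    rewrite !ffunE; have [eV|_] := eqVneq V S; last by rewrite mul0r mulr0.
    by rewrite -eV VU in nSU.
  case: ifP => _; last by rewrite ffunE.
  rewrite ext_scaleE ffunE.
  have [eU|_] := eqVneq U; last by rewrite mulr0.
  by rewrite eU finset.subsetUl in nSU.
rewrite (bigD1 S) //= big1 ?addr0 => [|V /andP[_ /negPf VS]]; last first.
  by rewrite !ffunE VS mul0r mulr0.
rewrite !ffunE eqxx mul1r; case: ifP => dST.
  rewrite ext_scaleE ffunE.
  have -> : (U :\: S == T) = (U == S :|: T).
    apply/eqP/eqP => [<-|->]; first apply/setP => x.
      by rewrite !inE; case: (boolP (x \in S)) => // /(fintype.subsetP SU).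
    apply/setP => x; rewrite !inE; case: (boolP (x \in S)) => //= xS.
    by rewrite (disjointFr dST xS).
  case: eqP => [->|_]; last by rewrite !mulr0.
  congr (_ ^+ inversions _ _ * _).
  apply/setP => x; rewrite !inE; case: (boolP (x \in S)) => //= xS.
  by rewrite (disjointFr dST xS).
rewrite ffunE; case: eqP => [UT|_]; last by rewrite mulr0.
case/negP: (negbT dST); rewrite finset.disjoints_subset; apply/fintype.subsetP => x xS.
by rewrite -UT !inE xS.
Qed.

Lemma ext_genb (i : 'I_n) T : ext_gen K i * ext_basis K T =
  if i \in T then 0 else (-1) ^+ inversions [set i] T *: ext_basis K (i |: T).
Proof. by rewrite ext_basisM disjoints1; case: (i \in T). Qed.

(** A monomial is, up to sign, any one of its generators times the monomial in the remaining
    indices, so peeling generators off on the left ends at $1$. Identities over $E$ are thereby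
    checked on scalars and generators only. *)
Lemma ext_ind (P : E -> Prop) : P 1 -> (forall a b, P a -> P b -> P (a + b)) ->
  (forall k a, P a -> P (k *: a)) -> (forall i a, P a -> P (ext_gen K i * a)) ->
  forall a, P a.
Proof.
move=> P1 PD PZ PM a; rewrite (ext_decomp a).
have P0 : P 0 by rewrite -(scale0r (1 : E)); apply: (PZ).
elim/big_ind: _ => // S _; apply: (PZ).
have [m] := ubnP #|S|; elim: m S => // m IH S.
have [->|[i iS]] := finset.set_0Vmem S; first by [].
rewrite (cardsD1 i) iS ltnS => /IH PS.
have := PM i _ PS; rewrite ext_genb !inE eqxx /= finset.setD1K // => /(PZ ((-1) ^+ inversions [set i] (S :\ i))).
by rewrite scalerA -expr2 sqrr_sign scale1r.
Qed.

Lemma ext_deg_basis S : ext_deg #|S|%:Z (ext_basis K S).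
Proof. by move=> U; rewrite ffunE; have [->//|_] := eqVneq U S; rewrite eqxx. Qed.

Lemma ext_deg_gen (i : 'I_n) : ext_deg 1 (ext_gen K i).
Proof. by have := @ext_deg_basis [set i]; rewrite cards1. Qed.

Lemma ext_deg0 d : ext_deg d (0 : E).
Proof. by move=> S; rewrite ffunE eqxx. Qed.

Lemma ext_degD d a b : ext_deg d a -> ext_deg d b -> ext_deg d (a + b).
Proof.
move=> da db S; rewrite ffunE => ab; have [aS|/da//] := eqVneq (a S) 0.
by apply: db; rewrite aS add0r in ab.
Qed.

Lemma ext_degZ d k a : ext_deg d a -> ext_deg d (k *: a).
Proof. by move=> da S; rewrite ext_scaleE mulf_eq0 negb_or => /andP[_ /da]. Qed.

Lemma ext_deg_sum d (I : Type) (r : seq I) (F : I -> E) :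
  (forall i, ext_deg d (F i)) -> ext_deg d (\sum_(i <- r) F i).
Proof.
by move=> dF; elim/big_ind: _ => //; [exact: ext_deg0 | exact: ext_degD].
Qed.

Lemma ext_degM i j a b : ext_deg i a -> ext_deg j b -> ext_deg (i + j) (a * b).
Proof.
move=> da db S; rewrite ext_mulE => nz.
have [T TS] : exists2 T : {set _}, T \subset S & a T * b (S :\: T) != 0.
  apply: contrapT => no; case/eqP: nz; apply: big1 => T TS.
  have [->|nz] := eqVneq (a T * b (S :\: T)) 0; first by rewrite mulr0.
  by case: no; exists T.
rewrite mulf_eq0 negb_or => /andP[/da <- /db <-].
by rewrite -PoszD cardsD (finset.setIidPr TS) subnKC // subset_leq_card.
Qed.

Lemma ext_deg1E v : ext_deg 1 v -> v = \sum_(i < n) v [set i] *: ext_gen K i.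
Proof.
move=> dv; apply/ffunP => S; rewrite ext_sumE.
have [/cards1P[i ->]|cS] := boolP (#|S| == 1%N).
  rewrite (bigD1 i) //= ext_scaleE ffunE eqxx mulr1 big1 ?addr0 // => j ji.
  by rewrite ext_scaleE ffunE (inj_eq set1_inj) eq_sym (negPf ji) mulr0.
have -> : v S = 0 by apply/eqP; apply: contraNT cS => /dv[->].
rewrite big1 // => i _; rewrite ext_scaleE ffunE.
by have [eS|_] := eqVneq S [set i]; [rewrite eS cards1 in cS | rewrite mulr0].
Qed.

Lemma ext_deg0E a : ext_deg 0 a -> a = a finset.set0 *: 1.
Proof.
move=> da; apply/ffunP => S; rewrite ext_scaleE ffunE.
have [->|Sn0] := eqVneq S finset.set0; first by rewrite mulr1.
rewrite mulr0; apply/eqP; apply: contraNT Sn0 => /da[/eqP].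
by rewrite cards_eq0.
Qed.

Lemma ext_genMV (i : 'I_n) v : ext_deg 1 v -> ext_gen K i * v = - (v * ext_gen K i).
Proof.
move=> /ext_deg1E ->; rewrite mulr_sumr mulr_suml -sumrN; apply: eq_bigr => j _.
by rewrite -scalerAr -scalerAl ext_gen_anticomm scalerN.
Qed.

Lemma ext_deg1_anticomm u v : ext_deg 1 u -> ext_deg 1 v -> u * v = - (v * u).
Proof.
move=> /ext_deg1E -> dv; rewrite mulr_sumr mulr_suml -sumrN; apply: eq_bigr => j _.
by rewrite -scalerAl -scalerAr ext_genMV // scalerN.
Qed.

(** Anticommutativity gives only $2v^2=0$, which says nothing in characteristic 2. The sum is
    expanded instead: squares of generators vanish and cross terms cancel in pairs. *)
Lemma ext_deg1_sqr v : ext_deg 1 v -> v * v = 0.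
Proof.
move=> /ext_deg1E ->; elim: (index_enum _) => [|i r IH]; first by rewrite big_nil mulr0.
rewrite big_cons mulrDl !mulrDr IH addr0 -scalerAl -scalerAr ext_gen_sqr !scaler0 add0r.
rewrite (ext_deg1_anticomm (v := \sum_(j <- r) _)) ?addNr //.
  exact/ext_degZ/ext_deg_gen.
by apply: ext_deg_sum => j; apply/ext_degZ/ext_deg_gen.
Qed.

(** Brings a linear form to the front, so that the ideal generated by linear forms acts on a module
    through the images $vX$. *)
Lemma ext_deg1_swap v a : ext_deg 1 v -> exists b, a * v = v * b.
Proof.
move=> dv; elim/ext_ind: a => [|a b [a' ea] [b' eb]|k a [a' ea]|i a [a' ea]].
- by exists 1; rewrite mul1r mulr1.
- by exists (a' + b'); rewrite mulrDl mulrDr ea eb.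
- by exists (k *: a'); rewrite -scalerAl -scalerAr ea.
- by exists (- (ext_gen K i * a')); rewrite -mulrA ea !mulrA ext_genMV // mulNr mulrN mulrA.
Qed.

End Exterior.

(** * Regular sequences and ranks *)

Section AnticommutingMatrices.
Variables (K : fieldType) (N : nat).
Implicit Types (X Y : 'M[K]_N) (s : seq 'M[K]_N).

(** Squares are a separate condition because of characteristic 2. *)
Definition anticommuting s : Prop :=
  (forall X Y, X \in s -> Y \in s -> X *m Y = - (Y *m X)) /\
  (forall X, X \in s -> X *m X = 0).

(** Matrices act on row vectors, so a sum of row spaces stands for the submodule generated by the
    images of the preceding elements. Only one inclusion of $0:v=vM$ is asked, the other following
    from $v^2=0$; non-vanishing of the last quotient is treated separately. *)
Definition regular_mxs s : Prop :=
  forall i, (i < size s)%N -> forall x : 'rV[K]_N,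
    (x *m s`_i <= \sum_(X <- take i s) X)%MS ->
    (x <= \sum_(X <- take i s) X + s`_i)%MS.

Lemma prod_rcons s X : \prod_(Y <- rcons s X) Y = (\prod_(Y <- s) Y) *m X.
Proof. by rewrite -cats1 big_cat big_seq1. Qed.

Lemma anticommuting_rcons s X : anticommuting (rcons s X) -> anticommuting s.
Proof.
by move=> [h1 h2]; split=> [Y Z Ys Zs|Y Ys]; [apply: h1 | apply: h2]; rewrite mem_rcons inE ?Ys ?Zs orbT.
Qed.

Lemma prod_anticomm s X : (forall Y, Y \in s -> Y *m X = - (X *m Y)) ->
  (\prod_(Y <- s) Y) *m X = (-1) ^+ size s *: (X *m \prod_(Y <- s) Y).
Proof.
elim/last_ind: s => [|s Z IH] h; first by rewrite big_nil mul1mx mulmx1 scale1r.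
rewrite prod_rcons -mulmxA h ?mem_rcons ?inE ?eqxx // mulmxN [_ *m (X *m Z)]mulmxA IH => [|Y Ys]; last first.
  by apply: h; rewrite mem_rcons inE Ys orbT.
by rewrite size_rcons exprS mulN1r scaleNr -scalemxAl mulmxA.
Qed.

Lemma regular_mxs_rcons s X : regular_mxs (rcons s X) <->
  regular_mxs s /\ (forall x : 'rV[K]_N, (x *m X <= \sum_(Y <- s) Y)%MS ->
                      (x <= \sum_(Y <- s) Y + X)%MS).
Proof.
split=> [h|[h1 h2] i].
  split=> [i si|]; last first.
    have := h (size s); rewrite size_rcons ltnS leqnn nth_rcons ltnn eqxx.
    by rewrite -cats1 take_size_cat // => /(_ isT).
  have := h i; rewrite size_rcons nth_rcons si ltnS ltnW // -cats1 takel_cat ?(ltnW si) //.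
  by move/(_ isT).
rewrite size_rcons ltnS leq_eqVlt => /orP[/eqP ->|si].
  by rewrite nth_rcons ltnn eqxx -cats1 take_size_cat.
by rewrite nth_rcons si -cats1 takel_cat ?(ltnW si) //; apply: h1.
Qed.

(* On the image of W the operator X still squares to zero, so that its rank is at most half of
   the rank of W, with equality iff X is exact on it. *)
Lemma rank_anticomm_le (W X : 'M[K]_N) (a : K) : a != 0 -> W *m X = a *: (X *m W) -> X *m X = 0 ->
  (2 * \rank (W *m X) <= \rank W)%N /\
  ((2 * \rank (W *m X))%N = \rank W <-> (W :&: kermx X <= W *m X)%MS).
Proof.
move=> a0 WX XX.
have le1 : (W *m X <= W :&: kermx X)%MS.
  rewrite sub_capmx {1}WX scalemx_sub ?submxMl //=.
  by apply/sub_kermxP; rewrite -mulmxA XX mulmx0.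
have rk := mxrank_mul_ker W X.
have leq1 := mxrankS le1.
rewrite -rk mul2n -addnn leq_add2l; split=> //.
split=> [/addnI e|le2]; first by rewrite -(geq_leqif (mxrank_leqif_sup le1)) e.
by congr (_ + _)%N; apply/eqP; rewrite eqn_leq leq1 mxrankS.
Qed.

(** Moving [X] to the front of the product costs only a sign; there the image of [X] meets [X]
    again, and $X^2=0$. *)
Lemma sum_le_kermx_prod s : anticommuting s ->
  (\sum_(X <- s) X <= kermx (\prod_(X <- s) X))%MS.
Proof.
elim/last_ind: s => [|s X IH] h; first by rewrite !big_nil; apply: sub0mx.
rewrite -cats1 big_cat big_seq1 /= cats1 addsmx_sub; apply/andP; split.
  apply: submx_trans (IH (anticommuting_rcons h)) _.
  by apply/sub_kermxP; rewrite prod_rcons mulmxA mulmx_ker mul0mx.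
have Xs : X \in rcons s X by rewrite mem_rcons inE eqxx.
apply/sub_kermxP; rewrite prod_rcons prod_anticomm => [|Y Ys]; last first.
  by apply: (proj1 h) => //; rewrite mem_rcons inE Ys orbT.
by rewrite -scalemxAr mulmxA (proj2 h) // mul0mx scaler0.
Qed.

(** For a regular sequence with product $W$, the third clause identifies the quotient by the sum of
    the images with the image of $W$. Exactness of the next $X$ on the quotient thus becomes
    exactness on the image of $W$, which [rank_anticomm_le] detects by ranks. The induction carries
    the three clauses together. *)
Lemma regular_mxs_rank s : anticommuting s ->
  [/\ (2 ^ size s * \rank (\prod_(X <- s) X)%R <= N)%N,
      regular_mxs s <-> (2 ^ size s * \rank (\prod_(X <- s) X)%R)%N = N
    & regular_mxs s -> (kermx (\prod_(X <- s) X) <= \sum_(X <- s) X)%MS].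
Proof.
elim/last_ind: s => [_|s X IH h].
  rewrite !big_nil mul1n mxrank1; split=> // _; apply/row_subP => i.
  by have /sub_kermxP := row_sub i (kermx (1%:M : 'M[K]_N)); rewrite mulmx1 => ->; apply: sub0mx.
have [le_s reg_s ker_s] := IH (anticommuting_rcons h).
have Xs : X \in rcons s X by rewrite mem_rcons inE eqxx.
have XX := proj2 h _ Xs.
have sker := sum_le_kermx_prod (anticommuting_rcons h).
have WX : (\prod_(Y <- s) Y) *m X = (-1) ^+ size s *: (X *m \prod_(Y <- s) Y).
  by apply: prod_anticomm => Y Ys; apply: (proj1 h) => //; rewrite mem_rcons inE Ys orbT.
have a0 : (-1) ^+ size s != 0 :> K by rewrite signr_eq0.
have [le2 eq2] := rank_anticomm_le a0 WX XX.
rewrite size_rcons prod_rcons.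
have Sum : (\sum_(Y <- rcons s X) Y :=: \sum_(Y <- s) Y + X)%MS.
  by rewrite -cats1 big_cat big_seq1.
move: (\prod_(Y <- s) Y) WX le2 eq2 le_s reg_s ker_s sker => W WX le2 eq2 le_s reg_s ker_s sker.
have bnd : (2 ^ (size s).+1 * \rank (W *m X) <= 2 ^ size s * \rank W)%N.
  by rewrite expnSr -mulnA leq_mul2l le2 orbT.
have XWle (x : 'rV_N) : (x <= X *m W)%MS = (x <= W *m X)%MS.
  by rewrite WX (eqmx_scale _ a0).
have xker (x : 'rV_N) : (x *m X *m W == 0) = (x *m W *m X == 0).
  by rewrite -!mulmxA WX -scalemxAr scaler_eq0 (negPf a0).
split; first exact: leq_trans bnd le_s.
- split=> [/regular_mxs_rcons[rs rX]|e].
    rewrite expnSr -mulnA -[RHS](iffLR reg_s rs); congr (_ * _)%N.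
    apply/eq2/rV_subP => x; rewrite sub_capmx => /andP[/submxP[y ->] /sub_kermxP yWX].
    have : (y <= \sum_(Y <- s) Y + X)%MS.
      apply: rX; apply: submx_trans (ker_s rs); apply/sub_kermxP/eqP.
      by rewrite xker yWX.
    case/sub_addsmxP=> -[u v] /= ->; rewrite mulmxDl -!mulmxA.
    by rewrite (sub_kermxP sker) mulmx0 add0r -XWle submxMl.
  (* The chain $N=2^{|s|+1}\operatorname{rank}(WX)\le 2^{|s|}\operatorname{rank}W\le N$ forces
     equality at both places. *)
  have es : (2 ^ size s * \rank W)%N = N.
    by apply/eqP; rewrite eqn_leq le_s -{1}e bnd.
  have e2 : (2 * \rank (W *m X))%N = \rank W.
    have p2 : (0 < 2 ^ size s)%N by rewrite expn_gt0.
    by apply/eqP; rewrite -(eqn_pmul2l p2) es mulnA -expnSr e.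
  apply/regular_mxs_rcons; split; first exact/reg_s.
  move=> x /submx_trans/(_ sker)/sub_kermxP/eqP; rewrite xker => /eqP xWX.
  have : (x *m W <= W :&: kermx X)%MS by rewrite sub_capmx submxMl; apply/sub_kermxP.
  (* Exactness on the image of $W$ gives $xW=yXW$, so $x-yX$ lies in the kernel of $W$, which is the
     sum of the images. *)
  move/submx_trans/(_ (iffLR eq2 e2)); rewrite -XWle => /submxP[y].
  rewrite mulmxA => /eqP; rewrite -subr_eq0 -mulmxBl => /eqP/sub_kermxP.
  move/submx_trans/(_ (ker_s (iffRL reg_s es))) => xy.
  by rewrite -[x](subrK (y *m X)) addmx_sub_adds ?submxMl.
case/regular_mxs_rcons=> rs rX; rewrite Sum; apply/rV_subP => x /sub_kermxP xWX.
apply: rX; apply: submx_trans (ker_s rs); apply/sub_kermxP/eqP.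
by rewrite xker -mulmxA xWX.
Qed.

End AnticommutingMatrices.

(** * Modules in $K$-coordinates and the rank criterion for regular sequences *)

Section Coordinates.
Variables (K : fieldType) (n : nat).
Local Notation E := (extalg K n).

Lemma ext_algC (k : K) (a : E) : a * k%:A = k%:A * a.
Proof. by rewrite mulr_algl mulr_algr. Qed.

(** An [lmodType E] carries no separate $K$-structure; scalars act through [k%:A]. *)
Definition klinear (X Y : lmodType E) (T : X -> Y) : Prop :=
  {morph T : x y / x + y} /\ forall (k : K) x, T (k%:A *: x) = k%:A *: T x.

Definition coordinates (X : lmodType E) N (c : X -> 'rV[K]_N) : Prop :=
  [/\ bijective c, {morph c : x y / x + y} & forall (k : K) x, c (k%:A *: x) = k *: c x].

Lemma klinear_scale (X : lmodType E) (a : E) : klinear ( *:%R a : X -> X).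
Proof.
by split=> [x y|k x]; [rewrite scalerDr | rewrite !scalerA ext_algC].
Qed.

Section Theory.
Variables (X : lmodType E) (N : nat) (c : X -> 'rV[K]_N).
Hypothesis cP : coordinates c.

Lemma coord_inj : injective c. Proof. by case: cP => /bij_inj. Qed.

Lemma coordD x y : c (x + y) = c x + c y. Proof. by case: cP. Qed.

Lemma coordZ (k : K) x : c (k%:A *: x) = k *: c x. Proof. by case: cP. Qed.

Lemma coord0 : c 0 = 0.
Proof. by apply: (addrI (c 0)); rewrite -coordD !addr0. Qed.

Lemma coordN x : c (- x) = - c x.
Proof. by apply: (addrI (c x)); rewrite -coordD !subrr coord0. Qed.

Lemma coordB x y : c (x - y) = c x - c y.
Proof. by rewrite coordD coordN. Qed.

Lemma coord_sum (I : Type) (r : seq I) (P : pred I) (F : I -> X) :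
  c (\sum_(i <- r | P i) F i) = \sum_(i <- r | P i) c (F i).
Proof. exact: (big_morph c coordD coord0). Qed.

Lemma coord_surj (u : 'rV[K]_N) : exists x, c x = u.
Proof. by case: cP => -[ci _ cK] _ _; exists (ci u). Qed.

Lemma coord_eq0 x : (c x == 0) = (x == 0).
Proof. by rewrite -coord0 (inj_eq coord_inj). Qed.

Lemma coord_basis : exists u : 'I_N -> X,
  (forall i, c (u i) = delta_mx 0 i) /\ forall x, x = \sum_i (c x 0 i)%:A *: u i.
Proof.
have [u cu] := choice (fun i => coord_surj (delta_mx 0 i)).
exists u; split=> // x; apply: coord_inj; rewrite coord_sum {1}(row_sum_delta (c x)).
by apply: eq_bigr => i _; rewrite coordZ cu.
Qed.

End Theory.

Lemma klinear_mx (X Y : lmodType E) N N' (c : X -> 'rV[K]_N) (c' : Y -> 'rV[K]_N') (T : X -> Y) :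
  coordinates c -> coordinates c' -> klinear T -> exists A, forall x, c' (T x) = c x *m A.
Proof.
move=> cP cP' [TD TZ]; have [u [cu xu]] := coord_basis cP.
exists (\matrix_i c' (T (u i))) => x.
have T0 : T 0 = 0 by apply: (addrI (T 0)); rewrite -TD !addr0.
rewrite [in LHS](xu x) (big_morph T TD T0) (coord_sum cP') mulmx_sum_row.
by apply: eq_bigr => i _; rewrite TZ (coordZ cP') rowK.
Qed.

(** In finite dimension the matrix of a surjective endomorphism is invertible. This serves for
    [untwist], where surjectivity is the accessible half of bijectivity. *)
Lemma klinear_surj_inj (X : lmodType E) N (c : X -> 'rV[K]_N) (T : X -> X) :
  coordinates c -> klinear T -> (forall y, exists x, T x = y) -> injective T.
Proof.
move=> cP Tl Ts; have [A TA] := klinear_mx cP cP Tl.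
have full : row_full A.
  apply/row_fullP; have [u [cu _]] := coord_basis cP.
  have [v Tv] := choice (fun i => Ts (u i)).
  exists (\matrix_i c (v i)); apply/row_matrixP => i.
  by rewrite row_mul rowK -TA Tv cu row1.
move=> x y /(congr1 c); rewrite !TA => /(row_free_inj _) xy; apply: (coord_inj cP).
by apply: xy; rewrite row_free_unit -row_full_unit.
Qed.

(** A coordinate belongs to a row, a column and a monomial; [idx] is exposed because degrees are
    read off from it later. *)
Lemma matrix_coordinates p q : exists N (c : 'M[E]_(p, q) -> 'rV[K]_N)
    (idx : 'I_N -> 'I_p * 'I_q * {set 'I_n}),
  [/\ coordinates c, forall t, exists i, idx i = t
    & forall x i, c x 0 i = x (idx i).1.1 (idx i).1.2 (idx i).2].
Proof.
pose J : finType := ('I_p * 'I_q * {set 'I_n})%type.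
exists #|J|, (fun x : 'M[E]_(p, q) =>
  \row_(i < #|J|) x (enum_val i).1.1 (enum_val i).1.2 (enum_val i).2), (fun i => enum_val i).
split=> [|t|x i]; last by rewrite mxE.
  split=> [|x y|k x]; last 2 first.
  - by apply/rowP => i; rewrite !mxE ffunE.
  - by apply/rowP => i; rewrite !mxE mulr_algl ext_scaleE.
  exists (fun u : 'rV[K]_#|J| =>
      \matrix_(i, j) [ffun S => u 0 (enum_rank ((i, j), S) : 'I_#|J|)] : 'M[E]_(p, q)).
    by move=> x; apply/matrixP => i j; apply/ffunP => S; rewrite !mxE ffunE !mxE enum_rankK.
  by move=> u; apply/rowP => i; rewrite !mxE ffunE -!surjective_pairing enum_valK.
by exists (enum_rank (t : J)); rewrite enum_rankK.
Qed.

Lemma action_mx (X : lmodType E) N (c : X -> 'rV[K]_N) : coordinates c ->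
  exists A : E -> 'M[K]_N, forall a x, c (a *: x) = c x *m A a.
Proof.
move=> cP; have [A AP] := choice (fun a => klinear_mx cP cP (klinear_scale X a)).
by exists A => a x; apply: AP.
Qed.

Section Action.
Variables (X : lmodType E) (N : nat) (c : X -> 'rV[K]_N) (A : E -> 'M[K]_N).
Hypotheses (cP : coordinates c) (AP : forall a x, c (a *: x) = c x *m A a).

Lemma action_mx_eq (B C : 'M[K]_N) : (forall x, c x *m B = c x *m C) -> B = C.
Proof.
by move=> h; apply/row_matrixP => i; have [x cx] := coord_surj cP (delta_mx 0 i);
  rewrite !rowE -cx h.
Qed.

(** Acting on row vectors from the right reverses the order of the factors. *)
Lemma action_mxM a b : A (a * b) = A b *m A a.
Proof. by apply: action_mx_eq => x; rewrite mulmxA -!AP scalerA. Qed.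

Lemma action_mxN a : A (- a) = - A a.
Proof.
by apply: action_mx_eq => x; rewrite -AP scaleNr (coordN cP) AP mulmxN.
Qed.

Lemma action_mx0 : A 0 = 0.
Proof. by apply: action_mx_eq => x; rewrite -AP scale0r mulmx0 (coord0 cP). Qed.

Lemma action_mx_anticommuting (s : seq E) : (forall v, v \in s -> ext_deg 1 v) ->
  anticommuting (map A s).
Proof.
move=> ds; split=> [Y Z /mapP[u us ->] /mapP[v vs ->]|Y /mapP[v vs ->]].
  by rewrite -!action_mxM -action_mxN (ext_deg1_anticomm (ds _ us) (ds _ vs)) opprK.
by rewrite -action_mxM (ext_deg1_sqr (ds _ vs)) action_mx0.
Qed.

(** By [ext_deg1_swap] a generator can be moved in front of all other factors, so the submodule
    generated by the ideal is just the sum of the images of the linear forms. *)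
Lemma ideal_modP (s : seq E) x : (forall v, v \in s -> ext_deg 1 v) ->
  x \in @ideal_mod E X s <-> (c x <= \sum_(Y <- map A s) Y)%MS.
Proof.
move=> ds; split=> [/asboolP[t [ht ->]]|].
  rewrite (coord_sum cP) big_seq; apply: summx_sub => p /ht[u [hu ->]].
  rewrite scaler_suml (coord_sum cP) big_seq; apply: summx_sub => q /hu qs.
  have [b ->] := ext_deg1_swap q.1.1 (ds _ qs).
  rewrite -mulrA -scalerA AP; apply: submx_trans (submxMl _ _) _.
  by rewrite (big_rem (A q.1.2)) ?map_f //= addsmxSl.
elim: s x {ds} => [|v s IH] x.
  by rewrite big_nil submx0 (coord_eq0 cP) => /eqP ->; apply: rpred0.
rewrite big_cons => /sub_addsmxP[[u w] /=].
have [y <-] := coord_surj cP u; rewrite -AP => e.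
have : c (x - v *: y) = w *m (\sum_(Y <- map A s) Y)%MS.
  by rewrite (coordB cP) e addrC addKr.
move=> /(congr1 (fun z => z <= \sum_(Y <- map A s) Y)%MS); rewrite submxMl => /IH/asboolP[t [ht et]].
apply/asboolP; exists ((v, y) :: t); split; last by rewrite big_cons -et addrC subrK.
move=> p; rewrite inE => /orP[/eqP -> /=|/ht[t' [ht' ->]]]; last first.
  by exists t'; split=> // q /ht'; rewrite inE orbC => ->.
exists [:: (1, v, 1)]; rewrite big_seq1 /= mul1r mulr1; split=> // q.
by rewrite !inE => /eqP ->; rewrite eqxx.
Qed.

Lemma quotmod_eq0 (s : seq E) (x : X) : (\pi_(quotmod X s) x == 0)%qT = (x \in @ideal_mod E X s).
Proof.
have <- : (\pi_(quotmod X s) 0 = 0)%qT by apply: (addrI (\pi_(quotmod X s) 0)%qT); rewrite -quot_piD !addr0.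
by rewrite -Quotient.idealrBE subr0.
Qed.

(** The inclusion $vX\subseteq 0:v$ is automatic from $v^2=0$; what remains is the other one, lifted
    from the quotient to [X]. *)
Lemma regular_eltP (s : seq E) v : ext_deg 1 v -> (forall u, u \in s -> ext_deg 1 u) ->
  regular_elt (quotmod X s) v <-> forall y : 'rV[K]_N,
    (y *m A v <= \sum_(Y <- map A s) Y)%MS -> (y <= \sum_(Y <- map A s) Y + A v)%MS.
Proof.
move=> dv ds; split=> [reg y|h].
  have [x <-] := coord_surj cP y; rewrite -AP => /(ideal_modP _ ds) vx.
  have zx : [set m : quotmod X s | v *: m = 0]%classic (\pi_(quotmod X s) x)%qT.
    by apply/eqP; rewrite -[_ *: _]/(quot_scale v _) quot_scale_pi quotmod_eq0.
  have [z _] : [set v *: m | m in [set: quotmod X s]]%classic (\pi_(quotmod X s) x)%qT.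
    by move: reg; rewrite /regular_elt => <-.
  elim/quotW: z => z; rewrite -[_ *: _]/(quot_scale v _) quot_scale_pi.
  move/esym/eqP; rewrite -Quotient.idealrBE => /(ideal_modP _ ds).
  rewrite (coordB cP) AP => xz.
  by rewrite -[c x](subrK (c z *m A v)) addmx_sub_adds ?submxMl.
apply/seteqP; split=> z /=; elim/quotW: z => z.
  rewrite -[_ *: _]/(quot_scale v _) quot_scale_pi => /eqP; rewrite quotmod_eq0 => /(ideal_modP _ ds).
  rewrite AP => /h /sub_addsmxP[[u w] /= e].
  have [y cy] := coord_surj cP w.
  exists (\pi_(quotmod X s) y)%qT => //.
  apply/eqP; rewrite -[_ *: _]/(quot_scale v _) quot_scale_pi eq_sym -Quotient.idealrBE.
  by apply/(ideal_modP _ ds); rewrite (coordB cP) AP cy e addrK submxMl.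
case=> y _ <-; elim/quotW: y => y.
by rewrite scalerA ext_deg1_sqr // scale0r.
Qed.

Lemma regular_seqP (s : seq E) : (0 < N)%N ->
  regular_seq X s <-> (forall v, v \in s -> ext_deg 1 v) /\
    (2 ^ size s * \rank (\prod_(Y <- map A s) Y)%R)%N = N.
Proof.
move=> N0; split=> [[ds reg _]|[ds e]].
  split=> //; have ac := action_mx_anticommuting ds.
  have [_ [h _] _] := regular_mxs_rank ac; rewrite -(size_map A); apply: h => i.
  rewrite size_map => si; rewrite (nth_map 0) // -map_take.
  apply/(regular_eltP (ds _ (mem_nth _ si))); last exact: reg.
  by move=> u /mem_take /ds.
have ac := action_mx_anticommuting ds.
have [_ [_ h] _] := regular_mxs_rank ac; rewrite size_map in h.
split=> // [i si|].
  apply/(regular_eltP (ds _ (mem_nth _ si))) => [u /mem_take /ds //|].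
  by have := h e i; rewrite size_map (nth_map 0) // -map_take; apply.
(* If the quotient vanished, the sum of the images would be everything and the product zero, against
   the rank equality and $N>0$. *)
apply: contrapT => no.
have full x : x \in @ideal_mod E X s.
  by rewrite -quotmod_eq0; apply/eqP/eqP; apply: contra_notT no => nz; exists (\pi_(quotmod X s) x)%qT.
have W0 : \prod_(Y <- map A s) Y = 0.
  apply: action_mx_eq => x; rewrite mulmx0; apply/sub_kermxP.
  exact: submx_trans (iffLR (ideal_modP _ ds) (full x)) (sum_le_kermx_prod ac).
by move: e N0; rewrite W0 mxrank0 muln0 => <-.
Qed.

End Action.
End Coordinates.

(** * Homogeneous coordinates and duality *)

Section TopCoefficient.
Variables (K : fieldType) (n : nat).
Local Notation E := (extalg K n).

Lemma ext_basis_mul_top (T : {set 'I_n}) (a : E) :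
  (ext_basis K T * a) [set: 'I_n]%SET = (-1) ^+ inversions T (~: T) * a (~: T).
Proof.
rewrite ext_mulE (bigD1 T) ?finset.subsetT //= big1 ?addr0 => [|U /andP[_ /negPf UT]]; last first.
  by rewrite ffunE UT mul0r mulr0.
by rewrite ffunE eqxx mul1r finset.setTD.
Qed.

(** The top coefficient of $xa$ is the Frobenius pairing of $E$: multiplying by the monomial
    complementary to $S$ isolates the coefficient at $S$ up to sign. *)
Lemma ext_top_nondegenerate (a b : E) :
  (forall x : E, (x * a) [set: 'I_n]%SET = (x * b) [set: 'I_n]%SET) -> a = b.
Proof.
move=> ab; apply/ffunP => S; have := ab (ext_basis K (~: S)).
by rewrite !ext_basis_mul_top finset.setCK => /mulfI; apply; rewrite signr_eq0.
Qed.

End TopCoefficient.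

(** * Minimal homogeneous families over a subring of $E$ *)

Section MinimalFamilies.
Variables (K : fieldType) (n : nat).
Local Notation E := (extalg K n).
Variables (V : lmodType E) (A : E -> Prop) (D : int -> set V) (Z : V -> Prop).
Hypotheses (A0 : A 0) (A1 : A 1) (AB : forall a b, A a -> A b -> A (a - b))
  (AM : forall a b, A a -> A b -> A (a * b)).

(** [A] is taken to be the scalars in order to obtain a $K$-basis, and all of $E$ in order to obtain
    minimal generators. *)
Definition spanned (J : finType) (u : J -> V) (x : V) : Prop :=
  exists y : J -> E, (forall j, A (y j)) /\ x = \sum_j y j *: u j.

Lemma closedN a : A a -> A (- a). Proof. by rewrite -sub0r; apply: AB. Qed.

Lemma closedD a b : A a -> A b -> A (a + b).
Proof. by move=> Aa Ab; rewrite -[b]opprK; apply/AB/closedN. Qed.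

Section Closure.
Variables (J : finType) (u : J -> V).

Lemma spanned0 : spanned u 0.
Proof. by exists (fun=> 0); split=> //; rewrite big1 // => j _; rewrite scale0r. Qed.

Lemma spannedD x y : spanned u x -> spanned u y -> spanned u (x + y).
Proof.
move=> [a [Aa ->]] [b [Ab ->]]; exists (fun j => a j + b j); split=> [j|].
  exact: closedD.
by rewrite -big_split; apply: eq_bigr => j _; rewrite scalerDl.
Qed.

Lemma spannedZ a x : A a -> spanned u x -> spanned u (a *: x).
Proof.
move=> Aa [b [Ab ->]]; exists (fun j => a * b j); split=> [j|]; first exact: AM.
by rewrite scaler_sumr; apply: eq_bigr => j _; rewrite scalerA.
Qed.

Lemma spanned_sum (I : Type) (r : seq I) (P : pred I) (F : I -> V) :
  (forall i, P i -> spanned u (F i)) -> spanned u (\sum_(i <- r | P i) F i).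
Proof. by move=> h; elim/big_ind: _; [apply: spanned0 | apply: spannedD | apply: h]. Qed.

Lemma spanned_gen j : spanned u (u j).
Proof.
exists (fun i => if i == j then 1 else 0); split=> [i|]; first by case: ifP.
rewrite (bigD1 j) //= eqxx scale1r big1 ?addr0 // => i /negPf ->.
by rewrite scale0r.
Qed.

End Closure.

Definition homogeneous_family (J : finType) (u : J -> V) (d : J -> int) : Prop :=
  (forall j, Z (u j) /\ D (d j) (u j)) /\ forall x, Z x -> spanned u x.

(** A family of least size is chosen. A relation with a left-invertible coefficient would express
    that member through the others and give a shorter family. *)
Lemma minimal_family (J : finType) (u : J -> V) (d : J -> int) : homogeneous_family u d ->
  exists N (u : 'I_N -> V) (d : 'I_N -> int), homogeneous_family u d /\
    forall x : 'I_N -> E, (forall j, A (x j)) -> \sum_j x j *: u j = 0 ->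
      forall k a, A a -> a * x k != 1.
Proof.
move=> [uZ us].
pose P N := `[< exists (u : 'I_N -> V) (d : 'I_N -> int), homogeneous_family u d >].
have exP : exists N, P N.
  exists #|J|; apply/asboolP; exists (fun i => u (enum_val i)), (fun i => d (enum_val i)).
  split=> // x /us[y [Ay ->]]; apply: spanned_sum => j _; apply: spannedZ => //.
  by rewrite -[u j](congr1 u (enum_rankK j)); apply: (spanned_gen (fun i => u (enum_val i))).
have [N /asboolP[v [e [vZ vs]]] minN] := ex_minnP exP.
exists N, v, e; split=> // x Ax x0 k a Aa; apply/negP => /eqP ax1.
case: N v e vZ vs x Ax x0 k ax1 minN => [|N] v e vZ vs x Ax x0 k ax1 minN; first by case: k ax1.
suff /minN : P N by rewrite ltnn.
apply/asboolP; exists (v \o lift k), (e \o lift k); split=> [j|y /vs[b [Ab ->]]]; first exact: vZ.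
apply: spanned_sum => j _; apply: spannedZ => //.
have [j' ->|kj] := unliftP k j; first exact: (spanned_gen (v \o lift k)).
have -> : v j = \sum_i (- (a * x (lift k i))) *: v (lift k i).
  rewrite kj -[LHS]scale1r -ax1 -scalerA; move: x0; rewrite (bigD1_ord k) //= => /eqP.
  rewrite addr_eq0 => /eqP ->; rewrite scalerN scaler_sumr -sumrN.
  by apply: eq_bigr => i _; rewrite scalerA scaleNr.
apply: spanned_sum => i _; apply: spannedZ; last exact: (spanned_gen (v \o lift k)).
exact/closedN/AM.
Qed.

End MinimalFamilies.

Section GradedCoordinates.
Variables (K : fieldType) (n : nat).
Local Notation E := (extalg K n).

(** [d i] is the degree of the $i$-th basis vector, and the component of degree $j$ is exactly the
    span of the basis vectors of degree $j$. *)
Definition graded_coordinates (X : lmodType E) (D : int -> set X) N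
    (d : 'I_N -> int) (c : X -> 'rV[K]_N) : Prop :=
  [/\ coordinates c,
      forall j x, D j x <-> (forall i, c x 0 i != 0 -> d i = j)
    & forall i j a x, ext_deg i a -> D j x -> D (i + j) (a *: x)].

Lemma ext_deg_algC (k : K) : ext_deg 0 (k%:A : E).
Proof.
by apply: ext_degZ; have := @ext_deg_basis K n finset.set0; rewrite cards0.
Qed.

Lemma catM_coordinates (M : gbimod K n) : catM M ->
  exists N (d : 'I_N -> int) (c : M -> 'rV[K]_N), graded_coordinates (@gb_deg K n M) d c.
Proof.
move=> [[r [g gM]] [D0B Dex Dun] DM _ _].
(* Non-zero scalars are invertible, so a minimal spanning family over the scalars is a basis. *)
pose A (a : E) := exists k : K, a = k%:A.
have A0 : A 0 by exists 0; rewrite scale0r.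
have A1 : A 1 by exists 1; rewrite scale1r.
have AB a b : A a -> A b -> A (a - b) by move=> [k ->] [l ->]; exists (k - l); rewrite scalerBl.
have AM a b : A a -> A b -> A (a * b) by move=> [k ->] [l ->]; exists (k * l); rewrite -scalerAl mul1r scalerA.
have [t tP] := choice (fun k => Dex (g k)); have [h hP] := choice tP.
(* The spanning family consists of all monomials times the homogeneous components of the
   generators. *)
pose J : finType := ({k : 'I_r & 'I_(size (t k))} * {set 'I_n})%type.
pose idx (j : J) := nth 0 (t (tag j.1)) (tagged j.1).
pose u (j : J) : M := ext_basis K j.2 *: h (tag j.1) (idx j).
have hom : homogeneous_family A (@gb_deg K n M) (fun=> True) u (fun j => #|j.2|%:Z + idx j).
  split=> [j|x _]; first by split=> //; apply: DM; [apply: ext_deg_basis | apply: (hP _).1].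
  have [a ->] := gM x; apply: spanned_sum => // k _; rewrite (hP k).2 scaler_sumr big_seq.
  apply: spanned_sum => // i it; rewrite (ext_decomp (a k)) scaler_suml.
  apply: spanned_sum => // S _; rewrite -[_ *: ext_basis K S]mulr_algl -scalerA.
  apply: spannedZ => //; first by exists (a k S).
  have it' : (index i (t k) < size (t k))%N by rewrite index_mem.
  have -> : ext_basis K S *: h k i = u (Tagged (fun k => 'I_(size (t k))) (Ordinal it'), S).
    by rewrite /u /idx /= nth_index.
  exact: spanned_gen.
have {hom u idx J}[N [u [d [[uZ us] free]]]] := minimal_family A0 A1 AB AM hom.
have [y yP] := choice (fun x => us x I).
have [c cP] : exists c : M -> 'rV[K]_N, forall x, x = \sum_i (c x 0 i)%:A *: u i.
  have /choice[c cP] : forall x, exists w : 'rV[K]_N, x = \sum_i (w 0 i)%:A *: u i.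
    move=> x; have [z zP] := choice (yP x).1; exists (\row_i z i).
    by rewrite [LHS](yP x).2; apply: eq_bigr => i _; rewrite mxE -zP.
  by exists c.
have freeK (w : 'I_N -> K) : \sum_i (w i)%:A *: u i = 0 -> forall i, w i = 0.
  move=> w0 i; apply/eqP; apply: contraT => wi.
  have /negP[] := free (fun i => (w i)%:A) (fun j => ex_intro _ (w j) erefl) w0 i _
    (ex_intro _ (w i)^-1 erefl).
  by rewrite mulr_algl scalerA mulVf // scale1r.
have cE (w : 'rV[K]_N) x : x = \sum_i (w 0 i)%:A *: u i -> c x = w.
  move=> xw; apply/rowP => i; apply/eqP; rewrite -subr_eq0; apply/eqP.
  apply: (freeK (fun i => c x 0 i - w 0 i)).
  by under eq_bigr => j _ do rewrite scalerBl scalerBl; rewrite sumrB -cP -xw subrr.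
exists N, d, c; split=> //.
  split=> [|x y'|k x].
  - exists (fun w : 'rV[K]_N => \sum_i (w 0 i)%:A *: u i) => [x|w]; first by rewrite -cP.
    exact: cE.
  - apply: cE; rewrite {1}(cP x) {1}(cP y') -big_split; apply: eq_bigr => i _.
    by rewrite mxE !scalerDl.
  - apply: cE; rewrite {1}(cP x) scaler_sumr; apply: eq_bigr => i _.
    by rewrite mxE scalerA -scalerAl mul1r scalerA.
have D0 i : gb_deg (g:=M) i 0 by case: (D0B i).
have DN i x : gb_deg (g:=M) i x -> gb_deg i (- x) by move=> Dx; rewrite -sub0r; apply: (D0B i).2.
have DD i x z : gb_deg (g:=M) i x -> gb_deg i z -> gb_deg i (x + z).
  by move=> Dx Dz; rewrite -[z]opprK; apply: (D0B i).2 => //; apply: DN.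
have DZ i (k : K) x : gb_deg (g:=M) i x -> gb_deg i (k%:A *: x).
  by move=> Dx; rewrite -[i]add0r; apply: DM => //; apply: ext_deg_algC.
have Dsum i (P : pred 'I_N) (F : 'I_N -> M) : (forall a, P a -> gb_deg i (F a)) ->
    gb_deg i (\sum_(a | P a) F a).
  by move=> DF; elim/big_ind: _; [apply: D0 | apply: DD | apply: DF].
move=> j x; split=> [Dx i ci|cd]; last first.
  rewrite (cP x); apply: Dsum => i _.
  have [->|/cd <-] := eqVneq (c x 0 i) 0; last by apply: DZ; apply: (uZ i).2.
  by rewrite !scale0r.
apply: contrapT => dij; case/eqP: ci.
(* [w] is the degree-wise expansion of [x] minus [x] itself placed in degree [j]. Its sum is zero,
   so directness of the grading kills every component, in particular the one of degree [d i], which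
   differs from [j]. *)
pose w l := \sum_(a | d a == l) (c x 0 a)%:A *: u a - (if l == j then x else 0).
pose s := undup (j :: [seq d a | a : 'I_N]).
have ws : \sum_(l <- s) w l = 0.
  rewrite sumrB -big_mkcond -big_filter filter_pred1_uniq ?undup_uniq ?mem_undup ?mem_head //.
  rewrite big_seq1 (exchange_big_dep predT) //= {2}(cP x); apply/eqP; rewrite subr_eq0; apply/eqP.
  apply: eq_bigr => a _; rewrite (eq_bigl (pred1 (d a))); last by move=> l; rewrite /= eq_sym.
  rewrite -big_filter filter_pred1_uniq ?undup_uniq ?big_seq1 // mem_undup inE.
  by rewrite map_f ?orbT // mem_enum.
have Dw l : gb_deg l (w l).
  apply: (DD); last by apply: DN; case: eqP => [->|].
  by apply: (Dsum) => a /eqP <-; apply: (DZ); apply: (uZ a).2.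
have ds : d i \in s by rewrite mem_undup inE map_f ?orbT // mem_enum.
have e := Dun s w (undup_uniq _) Dw ws _ ds.
have /freeK : \sum_a (if d a == d i then c x 0 a else 0)%:A *: u a = 0.
  rewrite -[RHS]e /w (negbTE (introN eqP dij)) subr0 [RHS]big_mkcond.
  by apply: eq_bigr => a _; case: ifP => // _; rewrite !scale0r.
by move/(_ i); rewrite eqxx.
Qed.

End GradedCoordinates.

Section DualCoordinates.
Variables (K : fieldType) (n : nat) (M : gbimod K n).
Local Notation E := (extalg K n).
Variables (N : nat) (d : 'I_N -> int) (c : M -> 'rV[K]_N).
Hypotheses (M_catM : catM M) (cP : graded_coordinates (@gb_deg K n M) d c).

Let coordsP : coordinates c. Proof. by case: cP. Qed.

Let signA k : (-1) ^+ k = ((-1) ^+ k : K)%:A :> E.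
Proof. by elim: k => [|k IH]; rewrite ?scale1r // !exprS IH !mulN1r scaleNr. Qed.

Definition degree_sign : 'M[K]_N := diag_mx (\row_a (-1) ^+ `|d a|%N).

(** The coordinates of $f$ are the top coefficients of its values on the basis of $M$. A map of
    degree $j$ has a top coefficient on a basis vector of degree $d_a$ only if $d_a+j=n$, whence the
    degrees $n-d_a$. The factor [degree_sign] appears when the right action in $(vf)(m)=f(mv)$ is
    turned into the left action of $v$ on $m$. *)
Lemma dual_coordinates : exists c' : Edual M -> 'rV[K]_N,
  graded_coordinates (@gb_deg K n (Edual M)) (fun a => n%:Z - d a) c' /\
  forall v (A : 'M[K]_N), ext_deg 1 v -> (forall x, c (v *: x) = c x *m A) ->
    forall f, c' (v *: f) = c' f *m (A^T *m degree_sign).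
Proof.
have [_ degP degM] := cP.
have [_ _ _ rdegM signM] := M_catM.
have [u [cu xu]] := coord_basis coordsP.
have udeg a : gb_deg (d a) (u a).
  by apply/degP => b; rewrite cu mxE eqxx /=; have [->//|_] := eqVneq b a; rewrite eqxx.
pose c' (f : Edual M) : 'rV[K]_N := \row_a ehom_fun f (u a) [set: 'I_n]%SET.
have fM (f : Edual M) a m : ehom_fun f (a *: m) = a * ehom_fun f m by rewrite /ehom_fun linearZ.
have fsum (f : Edual M) (F : 'I_N -> M) : ehom_fun f (\sum_a F a) = \sum_a ehom_fun f (F a).
  by rewrite /ehom_fun linear_sum.
have topE (f : Edual M) m :
    ehom_fun f m [set: 'I_n]%SET = \sum_a c m 0 a * c' f 0 a.
  rewrite {1}(xu m) fsum ext_sumE; apply: eq_bigr => a _.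
  by rewrite fM mulr_algl ext_scaleE mxE.
have inj : injective c'.
  move=> f g fg; apply: ehomP => m; apply: ext_top_nondegenerate => x.
  by rewrite -!fM !topE fg.
have surj (w : 'rV[K]_N) : exists f, c' f = w.
  pose phi m := \sum_a c m 0 a * w 0 a.
  have phiD x y : phi (x + y) = phi x + phi y.
    by rewrite -big_split; apply: eq_bigr => a _; rewrite (coordD coordsP) mxE mulrDl.
  have phi0 : phi 0 = 0 by apply: (addrI (phi 0)); rewrite -phiD !addr0.
  have phiZ (k : K) x : phi (k%:A *: x) = k * phi x.
    by rewrite mulr_sumr; apply: eq_bigr => a _; rewrite (coordZ coordsP) mxE mulrA.
  (* Testing against complementary monomials inverts the top-coefficient pairing, so the
     coefficients of [F m] are forced by [phi]. *)
  have /choice[F FP] m : exists y : E, forall x, (x * y) [set: 'I_n]%SET = phi (x *: m).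
    exists [ffun S : {set 'I_n} => (-1) ^+ inversions (~: S) S * phi (ext_basis K (~: S) *: m)].
    move=> x; rewrite (ext_decomp x) mulr_suml scaler_suml ext_sumE (big_morph phi phiD phi0).
    apply: eq_bigr => T _; rewrite -scalerAl ext_scaleE -mulr_algl -scalerA phiZ; congr (_ * _).
    by rewrite ext_basis_mul_top ffunE finset.setCK mulrA -expr2 sqrr_sign mul1r.
  have Flin : linear (F : M -> E^o).
    move=> a x y; apply: ext_top_nondegenerate => b.
    rewrite mulrDr [in RHS]ffunE [_ *: _ : E^o]/(a * _) mulrA !FP scalerDr scalerA.
    exact: phiD.
  pose f : {linear M -> E^o} := HB.pack (F : M -> E^o) (GRing.isLinear.Build E M E^o _ _ Flin).
  have fE m : ehom_fun f m = F m by [].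
  exists f; apply/rowP => a; rewrite mxE fE -[F _]mul1r FP scale1r.
  rewrite /phi cu (bigD1 a) //= mxE !eqxx mul1r big1 ?addr0 // => b ba.
  by rewrite mxE (negPf ba) mul0r.
have ractE i x a : ext_deg i x ->
    gb_ract (u a) x = ((-1) ^+ `|(i * d a)%R|%N : K)%:A *: (x *: u a).
  by move=> dx; rewrite (signM _ _ _ _ dx (udeg a)) -signA scalerA -expr2 sqrr_sign scale1r.
have lactE x (f : Edual M) m : ehom_fun (x *: f) m = ehom_fun f (gb_ract m x) by [].
exists c'; split; first split.
- split=> [|f g|k f].
  + by have [g gP] := choice surj; exists g => // f; apply: inj; rewrite gP.
  + by apply/rowP => a; rewrite !mxE [LHS]ffunE.
  + apply/rowP => a; rewrite !mxE lactE (ractE 0) ?mul0r ?expr0 ?scale1r; last exact: ext_deg_algC.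
    by rewrite fM mulr_algl ext_scaleE.
- move=> j f; split=> [fj a|fj i m mi S].
    rewrite mxE => /(fj _ _ (udeg a)); rewrite cardsT card_ord => ->.
    by rewrite addrAC subrr add0r.
  rewrite -[S]finset.setCK => nz.
  have : (ext_basis K (~: S) * ehom_fun f m) [set: 'I_n]%SET != 0.
    by rewrite ext_basis_mul_top mulf_neq0 ?signr_eq0.
  rewrite -fM topE => nz'.
  have [a] : exists a, c (ext_basis K (~: S) *: m) 0 a * c' f 0 a != 0.
    apply: contrapT => no; case/eqP: nz'; apply: big1 => a _.
    by apply/eqP; apply: contrapT => nz'; apply: no; exists a; apply/negP.
  rewrite mulf_eq0 negb_or => /andP[ca /fj <-].
  have /degP/(_ _ ca) -> := degM _ _ _ _ (@ext_deg_basis K n (~: S)) mi.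
  rewrite finset.setCK -[X in X%:Z - _](card_ord n) -(cardsC S) PoszD.
  by rewrite opprD [X in i + X]addrA addrK addrCA subrr addr0.
- move=> i j x f dx fj k m mk S; rewrite lactE => /(fj _ _ (rdegM _ _ _ _ dx mk)) ->.
  by rewrite addrA.
move=> v A dv vA f; apply/rowP => a.
rewrite mulmxA mul_mx_diag !mxE lactE (ractE 1) // mul1r.
rewrite fM mulr_algl ext_scaleE topE vA cu -rowE mulrC; congr (_ * _).
by apply: eq_bigr => b _; rewrite !mxE mulrC.
Qed.

End DualCoordinates.

(** * Minimal resolutions and Betti numbers *)

Section Components.
Variables (K : fieldType) (n : nat).
Local Notation E := (extalg K n).

Definition ext_comp (j : int) (a : E) : E := [ffun S : {set 'I_n} => if #|S|%:Z == j then a S else 0].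

Lemma ext_comp_deg j a : ext_deg j (ext_comp j a).
Proof. by move=> S; rewrite ffunE; case: (#|S|%:Z =P j) => // _; rewrite eqxx. Qed.

Lemma ext_compM i j a b : ext_deg i b -> ext_comp j (a * b) = ext_comp (j - i) a * b.
Proof.
move=> db; apply/ffunP => S; rewrite ffunE !ext_mulE.
under [RHS]eq_bigr => T TS do rewrite ffunE.
case: ifP => [/eqP <-|Sj]; last first.
  rewrite big1 // => T TS; case: ifP => [/eqP eT|]; last by rewrite mul0r mulr0.
  have [->|/db eb] := eqVneq (b (S :\: T)) 0; first by rewrite !mulr0.
  move: Sj; rewrite -(subrK i j) -eT -eb -PoszD cardsD (finset.setIidPr TS).
  by rewrite subnKC ?eqxx // subset_leq_card.
apply: eq_bigr => T TS; have [->|/db <-] := eqVneq (b (S :\: T)) 0; first by rewrite !mulr0.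
by rewrite cardsD (finset.setIidPr TS) -subzn ?subset_leq_card // opprB addrC subrK eqxx.
Qed.

Lemma ext_comp_id j a : ext_deg j a -> ext_comp j a = a.
Proof.
move=> da; apply/ffunP => S; rewrite ffunE; case: eqP => // Sj.
by apply/esym/eqP; apply: contra_notT Sj => /da.
Qed.

Lemma ext_comp_sum j (I : Type) (r : seq I) (P : pred I) (F : I -> E) :
  ext_comp j (\sum_(i <- r | P i) F i) = \sum_(i <- r | P i) ext_comp j (F i).
Proof.
apply: (big_morph (ext_comp j)) => [a b|]; last first.
  by apply/ffunP => S; rewrite !ffunE if_same.
apply/ffunP => S; rewrite [RHS]ffunE !ffunE.
by case: ifP => // _; rewrite addr0.
Qed.

Definition mx_deg p q (d : 'I_p -> int) (e : 'I_q -> int) (X : 'M[E]_(p, q)) : Prop :=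
  forall k l, ext_deg (d k - e l) (X k l).

Definition mx_comp p q (d : 'I_p -> int) (e : 'I_q -> int) (X : 'M[E]_(p, q)) :=
  \matrix_(k, l) ext_comp (d k - e l) (X k l).

Lemma mx_comp_deg p q (d : 'I_p -> int) (e : 'I_q -> int) X : mx_deg d e (mx_comp d e X).
Proof. by move=> k l; rewrite mxE; apply: ext_comp_deg. Qed.

(** Projecting a factorization to its homogeneous part keeps it valid when the other two matrices
    are homogeneous; this makes liftings graded. *)
Lemma mx_comp_lift p q r (d : 'I_p -> int) (e : 'I_q -> int) (f : 'I_r -> int)
    (X : 'M[E]_(p, r)) Y (D : 'M[E]_(q, r)) : mx_deg d f X -> mx_deg e f D ->
  X = Y *m D -> X = mx_comp d e Y *m D.
Proof.
move=> dX dD XY; apply/matrixP => k l; rewrite -(ext_comp_id (dX k l)) XY !mxE ext_comp_sum.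
apply: eq_bigr => j _; rewrite (ext_compM _ _ (dD j l)) mxE.
by rewrite opprB addrA subrK.
Qed.

Lemma mx_degM p q r (d : 'I_p -> int) (e : 'I_q -> int) (f : 'I_r -> int)
    (X : 'M[E]_(p, q)) (Y : 'M[E]_(q, r)) : mx_deg d e X -> mx_deg e f Y -> mx_deg d f (X *m Y).
Proof.
move=> dX dY k l; rewrite mxE; apply: ext_deg_sum => j.
have -> : d k - f l = (d k - e j) + (e j - f l) by rewrite addrA subrK.
exact: ext_degM.
Qed.

Lemma lift_rows p q r (D : 'M[E]_(q, r)) (X : 'M[E]_(p, r)) :
  (forall k, exists y, row k X = y *m D) -> exists Y, X = Y *m D.
Proof.
move=> /choice[y yP]; exists (\matrix_k y k); apply/row_matrixP => k.
by rewrite row_mul rowK.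
Qed.

End Components.

(** * Comparison of complexes up to homotopy *)

Section Comparison.
Variables (R : nzRingType) (p q : nat -> nat).
Variables (D : forall i, 'M[R]_(p i.+1, p i)) (D' : forall i, 'M[R]_(q i.+1, q i)).
Variables (HA : forall i, 'M[R]_(p i, q i) -> Prop) (HB : forall i, 'M[R]_(q i, p i) -> Prop).
Hypotheses (DD : forall i, D i.+1 *m D i = 0) (DD' : forall i, D' i.+1 *m D' i = 0).
Hypothesis exD : forall i m (X : 'M[R]_(m, p i.+1)), X *m D i = 0 ->
  exists Y, X = Y *m D i.+1.
Hypothesis liftA : forall i (a : 'M[R]_(p i.+1, q i.+1)), HA a ->
  D i.+1 *m a *m D' i = 0 -> exists2 a' : 'M[R]_(p i.+2, q i.+2), HA a' & D i.+1 *m a = a' *m D' i.+1.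
Hypothesis liftB : forall i (b : 'M[R]_(q i.+1, p i.+1)), HB b ->
  D' i.+1 *m b *m D i = 0 -> exists2 b' : 'M[R]_(q i.+2, p i.+2), HB b' & D' i.+1 *m b = b' *m D i.+1.

(** [X] is the homotopy term coming from the preceding degree, zero at the bottom. The maps [a0] and
    [b0] one step below ensure that [a] and [b] respect cycles. *)
Definition homotopy_tail i : 'M[R]_(p i, q i) -> 'M[R]_(q i, p i) -> 'M[R]_(p i, p i) -> Prop :=
  match i with
  | 0 => fun _ _ X => X = 0
  | j.+1 => fun a b X => exists a0 b0 h,
      [/\ D j *m a0 = a *m D' j, D' j *m b0 = b *m D j & X = D j *m h]
  end.

(** The data of chain maps and a homotopy around a single degree, enough to pass to the next one, so
    that no infinite dependent family of maps has to be constructed. The predicates [HA] and [HB]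
    carry the grading where it is wanted. *)
Definition homotopic_identity i : Prop :=
  exists (a : 'M[R]_(p i, q i)) (b : 'M[R]_(q i, p i)) a' b' h X,
  [/\ [/\ HA a, HA a', HB b & HB b'],
      D i *m a = a' *m D' i, D' i *m b = b' *m D i,
      a *m b = 1%:M + h *m D i + X & D i *m X = 0 /\ homotopy_tail a b X].

Lemma comparison : homotopic_identity 0 -> forall i, homotopic_identity i.
Proof.
move=> h0; elim=> // i [a [b [a' [b' [h [X [[Ha Ha' Hb Hb'] ea eb ab [DX _]]]]]]]].
have [|a'' Ha'' ea''] := liftA Ha'; first by rewrite -mulmxA -ea mulmxA DD mul0mx.
have [|b'' Hb'' eb''] := liftB Hb'; first by rewrite -mulmxA -eb mulmxA DD' mul0mx.
(* The defect of the homotopy identity is annihilated by [D i], so exactness provides the next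
   homotopy. *)
have [|h' eh'] := exD (X := a' *m b' - 1%:M - D i *m h).
  rewrite !mulmxBl -mulmxA -eb mulmxA -ea -mulmxA ab mul1mx !mulmxDr mulmx1 DX addr0 mulmxA.
  by rewrite [_ + _ - D i]addrAC subrr add0r subrr.
exists a', b', a'', b'', h', (D i *m h); split=> //; last first.
  by split; [rewrite mulmxA DD mul0mx | exists a, b, h].
by rewrite -eh' -addrA subrK addrC subrK.
Qed.

End Comparison.

Section GradedModules.
Variables (K : fieldType) (n : nat).
Local Notation E := (extalg K n).
Variables (X : lmodType E) (D : int -> set X) (N : nat) (d : 'I_N -> int) (c : X -> 'rV[K]_N).
Hypothesis cP : graded_coordinates D d c.

Let coordsP : coordinates c. Proof. by case: cP. Qed.

(** Plays the part of the projection to degree [j]: each generator shifts the degree of its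
    coefficient by [e k]. *)
Lemma graded_sum_comp r (g : 'I_r -> X) (e : 'I_r -> int) (x : 'I_r -> E) j a :
  (forall k, D (e k) (g k)) ->
  c (\sum_k ext_comp (j - e k) (x k) *: g k) 0 a =
  if d a == j then c (\sum_k x k *: g k) 0 a else 0.
Proof.
move=> ge; have [_ degP degM] := cP.
have expand (y : E) k : c (y *: g k) 0 a = \sum_(S : {set 'I_n}) y S * c (ext_basis K S *: g k) 0 a.
  rewrite {1}(ext_decomp y) scaler_suml (coord_sum coordsP) summxE; apply: eq_bigr => S _.
  by rewrite -mulr_algl -scalerA (coordZ coordsP) mxE.
have -> : (if d a == j then c (\sum_k x k *: g k) 0 a else 0) =
    \sum_k if d a == j then c (x k *: g k) 0 a else 0.
  by case: ifP => _; [rewrite (coord_sum coordsP) summxE | rewrite big1].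
rewrite (coord_sum coordsP) summxE; apply: eq_bigr => k _; rewrite !expand.
have -> : (if d a == j then \sum_(S : {set 'I_n}) x k S * c (ext_basis K S *: g k) 0 a else 0) =
    \sum_(S : {set 'I_n}) if d a == j then x k S * c (ext_basis K S *: g k) 0 a else 0.
  by case: ifP => // _; rewrite big1.
apply: eq_bigr => S _; rewrite ffunE.
have [->|nz] := eqVneq (c (ext_basis K S *: g k) 0 a) 0; first by rewrite !mulr0 if_same.
have /degP/(_ _ nz) -> := degM _ _ _ _ (@ext_deg_basis K n S) (ge k).
by rewrite eq_sym subr_eq eq_sym; case: ifP; rewrite ?mul0r.
Qed.

Lemma graded_sum_comp0 r (g : 'I_r -> X) (e : 'I_r -> int) (x : 'I_r -> E) j :
  (forall k, D (e k) (g k)) -> \sum_k x k *: g k = 0 ->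
  \sum_k ext_comp (j - e k) (x k) *: g k = 0.
Proof.
move=> ge x0; apply/eqP; rewrite -(coord_eq0 coordsP); apply/eqP/rowP => a.
by rewrite graded_sum_comp // x0 (coord0 coordsP) mxE if_same.
Qed.

Lemma graded_sum_comp_id r (g : 'I_r -> X) (e : 'I_r -> int) (x : 'I_r -> E) j :
  (forall k, D (e k) (g k)) -> D j (\sum_k x k *: g k) ->
  \sum_k x k *: g k = \sum_k ext_comp (j - e k) (x k) *: g k.
Proof.
move=> ge Dx; apply: (coord_inj coordsP); apply/rowP => a; rewrite graded_sum_comp //.
case: eqP => // da; have [_ degP _] := cP; move/degP: Dx => Dx.
by apply/eqP; apply: contra_notT da => /Dx.
Qed.

(* A matrix of maximal rank with rows in [Z] spans [Z]; its rows are then split into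
   homogeneous components. *)
Lemma homogeneous_submodule_fg (Z : X -> Prop) : Z 0 ->
  (forall x y, Z x -> Z y -> Z (x + y)) -> (forall (k : K) x, Z x -> Z (k%:A *: x)) ->
  (forall j x, Z x -> exists2 y, Z y & forall a, c y 0 a = if d a == j then c x 0 a else 0) ->
  exists (J : finType) (u : J -> X) (e : J -> int), homogeneous_family (fun=> True) D Z u e.
Proof.
move=> Z0 ZD ZZ Zc; have [_ degP _] := cP.
pose cZ w := exists2 x, Z x & c x = w.
have cZ0 : cZ 0 by exists 0 => //; rewrite (coord0 coordsP).
have cZD v w : cZ v -> cZ w -> cZ (v + w).
  by move=> [x Zx <-] [y Zy <-]; exists (x + y); [apply: ZD | rewrite (coordD coordsP)].
have cZZ k w : cZ w -> cZ (k *: w).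
  by move=> [x Zx <-]; exists (k%:A *: x); [apply: ZZ | rewrite (coordZ coordsP)].
have cZsub (U : 'M_N) w : (forall i, cZ (row i U)) -> (w <= U)%MS -> cZ w.
  move=> UZ /submxP[y ->]; rewrite mulmx_sum_row; elim/big_ind: _ => // i _; exact: cZZ.
pose P k := `[< exists2 U : 'M[K]_N, forall i, cZ (row i U) & \rank U = k >].
have exP : exists k, P k.
  by exists 0%N; apply/asboolP; exists 0; rewrite ?mxrank0 // => i; rewrite row0.
have ubP k : P k -> (k <= N)%N by move=> /asboolP[U _ <-]; apply: rank_leq_row.
case: (ex_maxnP exP ubP) => k /asboolP[U UZ rU] maxk.
have Zsub z : Z z -> (c z <= U)%MS.
  move=> Zz; have : P (\rank (U + c z)%MS).
    apply/asboolP; exists (U + c z)%MS => // i; have := row_sub i (U + c z)%MS.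
    case/sub_addsmxP=> -[v w] /= ->; apply: cZD; first by apply: (cZsub U); rewrite ?submxMl.
    by rewrite [w]mx11_scalar mul_scalar_mx; apply: cZZ; exists z.
  move/maxk; rewrite -rU => le.
  have := mxrank_leqif_sup (addsmxSl U (c z)).
  by case=> le' e; rewrite (submx_trans (addsmxSr U (c z))) // -e eqn_leq le' le.
have /choice[x xP] : forall i, exists x : X, Z x /\ c x = row i U.
  by move=> i; have [y Zy cy] := UZ i; exists y.
have /choice[u uP] : forall t : 'I_N * 'I_N, exists y : X,
    Z y /\ forall a, c y 0 a = if d a == d t.2 then c (x t.1) 0 a else 0.
  by move=> t; have [y Zy cy] := Zc (d t.2) _ (xP t.1).1; exists y.
exists ('I_N * 'I_N)%type, u, (fun t => d t.2); split=> [t|z Zz].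
  split; first exact: (uP t).1.
  by apply/degP => a; rewrite (uP t).2; case: ifP => [/eqP //|_]; rewrite eqxx.
have /submxP[w cz] := Zsub _ Zz.
have -> : z = \sum_i (w 0 i)%:A *: x i.
  apply: (coord_inj coordsP); rewrite (coord_sum coordsP) cz mulmx_sum_row.
  by apply: eq_bigr => i _; rewrite (coordZ coordsP) (xP i).2.
apply: spanned_sum => // i _; apply: spannedZ => //.
(* The family [u] is indexed by basis vectors, not degrees; each occurring degree is represented by
   one basis vector of that degree. *)
have -> : x i = \sum_(j <- undup [seq d a | a : 'I_N]) 
    if [pick a | d a == j] is Some a then u (i, a) else 0.
  apply: (coord_inj coordsP); rewrite (coord_sum coordsP); apply/rowP => b; rewrite summxE.
  have db : d b \in undup [seq d a | a : 'I_N] by rewrite mem_undup map_f ?mem_enum.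
  rewrite (bigD1_seq _ db (undup_uniq _)) /= big1 ?addr0 => [|j jb].
    by case: pickP => [a /eqP da|/(_ b)]; rewrite ?eqxx // (uP _).2 /= da eqxx.
  case: pickP => [a /eqP da|_]; last by rewrite (coord0 coordsP) mxE.
  by rewrite (uP _).2 /= da eq_sym (negPf jb).
apply: spanned_sum => // j _; case: pickP => [a _|_]; [exact: spanned_gen | exact: spanned0].
Qed.

End GradedModules.

Section MinimalResolution.
Variables (K : fieldType) (n : nat).
Local Notation E := (extalg K n).

Definition rV_deg r (e : 'I_r -> int) (j : int) : set 'rV[E]_r :=
  [set x | forall k, ext_deg (j - e k) (x 0 k)]%classic.

Lemma rV_coordinates r (e : 'I_r -> int) : exists N d (c : 'rV[E]_r -> 'rV[K]_N),
  graded_coordinates (rV_deg e) d c.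
Proof.
have [N [c [idx [cP idxs cE]]]] := matrix_coordinates K n 1 r.
exists N, (fun i => #|(idx i).2|%:Z + e (idx i).1.2), c; split=> //.
- move=> j x; split=> [xj i|h k S xS].
    rewrite cE [(idx i).1.1]ord1 => /xj ->; exact: subrK.
  have [i ei] := idxs ((0, k), S); have := h i; rewrite cE ei /= => /(_ xS) <-.
  by rewrite addrK.
- by move=> i j a x ai xj k; rewrite mxE -addrA; apply: ext_degM.
Qed.

(** Minimality in the usual sense: homogeneous relations have coefficients in the augmentation
    ideal. *)
Definition minimal_generators (X : lmodType E) r (g : 'I_r -> X) (e : 'I_r -> int) : Prop :=
  forall x : 'rV[E]_r, \sum_k x 0 k *: g k = 0 ->
    forall j, rV_deg e j x -> forall k, x 0 k finset.set0 = 0.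

(** A homogeneous coefficient with non-zero constant term has degree 0, hence is an invertible
    scalar, which a family of least size excludes. *)
Lemma homogeneous_minimal_generators (X : lmodType E) (D : int -> set X) (Z : X -> Prop)
    (J : finType) (u : J -> X) (d : J -> int) :
  homogeneous_family (fun=> True) D Z u d ->
  exists r (g : 'I_r -> X) e, homogeneous_family (fun=> True) D Z g e /\ minimal_generators g e.
Proof.
move=> hu; have [//|//|//|//|r [g [e [hg ming]]]] := minimal_family _ _ _ _ hu.
exists r, g, e; split=> // x x0 j xj k; apply/eqP; apply: contraT => xk.
have ek : j - e k = 0 by have := xj k _ xk; rewrite cards0.
have := xj k; rewrite ek => /ext_deg0E xkE.
have /negP[] := ming (fun k => x 0 k) (fun=> I) x0 k (x 0 k finset.set0)^-1%:A I.
by rewrite mulr_algl xkE scalerA ext_scaleE ffunE eqxx mulr1 mulVf // scale1r.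
Qed.

Record presentation r (e : 'I_r -> int) := Presentation {
  pres_rank : nat;
  pres_deg : 'I_pres_rank -> int;
  pres_mx : 'M[E]_(pres_rank, r);
  pres_mx_deg : mx_deg pres_deg e pres_mx;
  pres_minimal : minimal_generators (fun k => row k pres_mx) pres_deg
}.

(** The kernel lies in a finite-dimensional space and is closed under homogeneous components, so it
    has minimal homogeneous generators. Being relations among minimal generators, they have no
    constant terms. *)
Lemma kernel_presentation (X : lmodType E) (D : int -> set X) N (d : 'I_N -> int)
    (c : X -> 'rV[K]_N) r (g : 'I_r -> X) e :
  graded_coordinates D d c -> (forall k, D (e k) (g k)) -> minimal_generators g e ->
  exists p : presentation e,
    (forall x : 'rV[E]_r, \sum_k x 0 k *: g k = 0 <-> exists y, x = y *m pres_mx p) /\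
    forall k l, pres_mx p k l finset.set0 = 0.
Proof.
move=> cP gD ming; have [N' [d' [c' cP']]] := rV_coordinates e.
pose Z (x : 'rV[E]_r) := \sum_k x 0 k *: g k = 0.
have ZD x y : Z x -> Z y -> Z (x + y).
  move=> Zx Zy; rewrite /Z; under eq_bigr => k _ do rewrite mxE scalerDl.
  by rewrite big_split /= Zx Zy addr0.
have ZZ a x : Z x -> Z (a *: x).
  move=> Zx; rewrite /Z; under eq_bigr => k _ do rewrite mxE -scalerA.
  by rewrite -scaler_sumr Zx scaler0.
have [|j x Zx|J [u [f hu]]] := homogeneous_submodule_fg cP' _ ZD (fun k x => ZZ k%:A x).
- by rewrite /Z big1 // => k _; rewrite mxE scale0r.
- exists (\row_k ext_comp (j - e k) (x 0 k)).
    rewrite /Z -[RHS](graded_sum_comp0 cP j gD Zx).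
    by apply: eq_bigr => k _; rewrite mxE.
  move=> a; rewrite (_ : \row_k _ = \sum_k ext_comp (j - e k) (x 0 k) *: delta_mx 0 k); last first.
    by rewrite [LHS]row_sum_delta; apply: eq_bigr => k _; rewrite mxE.
  rewrite {2}(row_sum_delta x); apply: (graded_sum_comp (D := rV_deg e) cP') => k l.
  rewrite mxE eqxx /=; have [->|_] := eqVneq l k; last exact: ext_deg0.
  by rewrite subrr -(scale1r 1%:R); apply: ext_deg_algC.
have [r' [h [e' [[hZ hs] minh]]]] := homogeneous_minimal_generators hu.
have rowE k : row k (\matrix_k h k) = h k by rewrite rowK.
have hdeg : mx_deg e' e (\matrix_k h k) by move=> k l; rewrite mxE; apply: (hZ k).2.
have hmin : minimal_generators (fun k => row k (\matrix_k h k)) e'.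
  by rewrite (_ : (fun k => _) = h) //; apply/funext.
exists (Presentation hdeg hmin); split=> [x|k l] /=.
  split=> [/hs[y [_ ->]]|[y ->]].
    exists (\row_k y k); rewrite mulmx_sum_row.
    by apply: eq_bigr => k _; rewrite mxE rowK.
  rewrite -/(Z _) mulmx_sum_row; elim/big_ind: _ => //.
    by rewrite /Z big1 // => k _; rewrite mxE scale0r.
  by move=> k _; rewrite rowK; apply/ZZ/(hZ k).1.
by rewrite mxE; apply: (ming _ (hZ k).1 _ (hZ k).2).
Qed.

(** Hides the rank and the degrees, so that the construction iterates within one type. *)
Record stage := Stage {
  stage_rank : nat;
  stage_deg : 'I_stage_rank -> int;
  stage_pres : presentation stage_deg
}.

Lemma next_presentation (s : stage) : exists p : presentation (pres_deg (p := stage_pres s)),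
  (forall x : 'rV[E]_(pres_rank (stage_pres s)), x *m pres_mx (stage_pres s) = 0 <->
     exists y, x = y *m pres_mx p) /\
  forall k l, pres_mx p k l finset.set0 = 0.
Proof.
case: s => r e [r' e' M Me minM] /=; have [N [d [c cP]]] := rV_coordinates e.
have [k l|p [pM p0]] := kernel_presentation cP (g := fun k => row k M) (e := e') _ minM.
  by rewrite mxE; apply: Me.
exists p; split=> // x; rewrite -pM mulmx_sum_row.
by split=> h; rewrite -[RHS]h; apply: eq_bigr.
Qed.

Definition next_stage (s : stage) : stage := Stage (sval (cid (next_presentation s))).

Theorem minimal_resolution (M : gbimod K n) N (d : 'I_N -> int) (c : M -> 'rV[K]_N) :
  graded_coordinates (@gb_deg K n M) d c ->
  exists F : free_resolution M, forall i k l, res_diff F i k l finset.set0 = 0.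
Proof.
move=> cP; have [coordsP degP degM] := cP; have [u [cu xu]] := coord_basis coordsP.
have hu : homogeneous_family (fun=> True) (@gb_deg K n M) (fun=> True) u d.
  split=> [a|x _]; last by exists (fun i => (c x 0 i)%:A).
  split=> //; apply/degP => b; rewrite cu mxE eqxx /=.
  by have [->//|_] := eqVneq b a; rewrite eqxx.
have [r [g [e [[gD gs] ming]]]] := homogeneous_minimal_generators hu.
have [p [pM p0]] := kernel_presentation cP (fun k => (gD k).2) ming.
pose st i := iter i next_stage (Stage p).
have res i x := (svalP (cid (next_presentation (st i)))).1 x.
have mn i k l : pres_mx (stage_pres (st i)) k l finset.set0 = 0.
  by case: i k l => [//|i]; apply: (svalP (cid (next_presentation (st i)))).2.
have surj (m : M) : exists x : 'rV[E]_r, m = \sum_k x 0 k *: g k.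
  have [y [_ ->]] := gs m I; exists (\row_k y k).
  by apply: eq_bigr => k _; rewrite mxE.
pose F := @FreeResolution K n M (fun i => stage_rank (st i)) (fun i => stage_deg (s := st i))
  g (fun i => pres_mx (stage_pres (st i))) (fun k => (gD k).2)
  (fun i => @pres_mx_deg _ _ (stage_pres (st i))) surj pM res.
by exists F.
Qed.

End MinimalResolution.

Section ConstantCoefficients.
Variables (K : fieldType) (n : nat).
Local Notation E := (extalg K n).

(** Applying the augmentation $E\to K$ entrywise is $K\otimes_E-$ on maps of free modules; on
    [res_diff] it gives [tensor_diff]. *)
Definition mx_const p q (X : 'M[E]_(p, q)) : 'M[K]_(p, q) := \matrix_(k, l) X k l finset.set0.

Lemma ext_constM (a b : E) : (a * b) finset.set0 = a finset.set0 * b finset.set0.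
Proof.
rewrite ext_mulE (bigD1 finset.set0) //= finset.setD0 inversions0s mul1r big1 ?addr0 //.
by move=> T; rewrite finset.subset0 => /andP[->].
Qed.

Lemma mx_constM p q r (X : 'M[E]_(p, q)) (Y : 'M[E]_(q, r)) :
  mx_const (X *m Y) = mx_const X *m mx_const Y.
Proof.
apply/matrixP => k l; rewrite !mxE ext_sumE; apply: eq_bigr => j _.
by rewrite !mxE ext_constM.
Qed.

Lemma mx_constD p q (X Y : 'M[E]_(p, q)) : mx_const (X + Y) = mx_const X + mx_const Y.
Proof. by apply/matrixP => k l; rewrite !mxE ffunE. Qed.

Lemma mx_const0 p q : mx_const (0 : 'M[E]_(p, q)) = 0.
Proof. by apply/matrixP => k l; rewrite !mxE ffunE. Qed.

Lemma mx_const1 p : mx_const (1%:M : 'M[E]_p) = 1%:M.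
Proof.
apply/matrixP => k l; rewrite !mxE; case: (k == l); last by rewrite ffunE.
by rewrite ffunE eqxx.
Qed.

(** A non-zero constant term has degree 0, so it links basis vectors of equal degree only. *)
Lemma mx_const_deg p q (d : 'I_p -> int) (e : 'I_q -> int) (X : 'M[E]_(p, q)) j :
  mx_deg d e X -> diag_mx (\row_k (d k == j)%:R) *m mx_const X =
                  mx_const X *m diag_mx (\row_k (e k == j)%:R).
Proof.
move=> dX; apply/matrixP => k l; rewrite mul_diag_mx mul_mx_diag !mxE.
have [->|/dX] := eqVneq (X k l finset.set0) 0; first by rewrite mulr0 mul0r.
by rewrite cards0 => /esym/eqP; rewrite subr_eq0 => /eqP ->; rewrite mulrC.
Qed.

End ConstantCoefficients.

(** [a] sends [Z] into [Z'], and only elements of [B] into [B'], so it embeds one subquotient into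
    the other; both are measured by their images in the cokernel of [B']. *)
Lemma subquotient_rank_le (F : fieldType) p q m m' (Z : 'M[F]_p) (B : 'M[F]_(m, p))
    (Z' : 'M[F]_q) (B' : 'M[F]_(m', q)) (a : 'M[F]_(p, q)) :
  (B' <= Z')%MS -> (Z *m a <= Z')%MS ->
  (forall z : 'rV[F]_p, (z <= Z)%MS -> (z *m a <= B')%MS -> (z <= B)%MS) ->
  (\rank Z - \rank B <= \rank Z' - \rank B')%N.
Proof.
move=> B'Z' Za h.
rewrite -(mxrank_mul_ker Z (a *m cokermx B')) -(mxrank_mul_ker Z' (cokermx B')).
have -> : \rank (Z' :&: kermx (cokermx B'))%MS = \rank B'.
  apply/eqmx_rank/andP; split; apply/rV_subP => z; rewrite sub_capmx.
    by case/andP=> _ /sub_kermxP zB; rewrite submxE zB.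
  by move=> zB; rewrite (submx_trans zB) //=; apply/sub_kermxP/eqP; rewrite -submxE.
rewrite addnK leq_subLR addnC leq_add //.
  apply: mxrankS; apply/rV_subP => z; rewrite sub_capmx => /andP[zZ /sub_kermxP za].
  by apply: h => //; rewrite submxE -mulmxA za.
by apply: mxrankS; rewrite mulmxA; apply: submxMr.
Qed.

Lemma rank_diag_pred (F : fieldType) p (P : pred 'I_p) :
  \rank (diag_mx (\row_k (P k)%:R) : 'M[F]_p) = #|P|.
Proof.
pose L : 'M[F]_(p, #|P|) := \matrix_(k, t) (k == enum_val t)%:R.
have LL : L^T *m L = 1%:M.
  apply/matrixP => s t; rewrite !mxE (bigD1 (enum_val s)) //= big1 => [|k ks]; last first.
    by rewrite !mxE (negPf ks) mul0r.
  by rewrite !mxE eqxx mul1r addr0 (inj_eq enum_val_inj).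
have dE : diag_mx (\row_k (P k)%:R) = L *m L^T.
  apply/matrixP => k l; rewrite !mxE; have [Pk|Pk] := boolP (P k); last first.
    rewrite mul0rn big1 // => t _; rewrite !mxE; case: eqP => [kt|_]; last by rewrite mul0r.
    by case/negP: Pk; rewrite kt; apply: enum_valP.
  rewrite (bigD1 (enum_rank_in Pk k)) //= big1 => [|t tk]; last first.
    rewrite !mxE; case: eqP => [kt|_]; last by rewrite mul0r.
    by case/eqP: tk; rewrite -[LHS](enum_valK_in Pk) -kt.
  by rewrite !mxE enum_rankK_in // eqxx mul1r addr0 eq_sym.
rewrite dE; apply/eqP; rewrite eqn_leq mulmx_max_rank /= -{1}(mxrank1 F #|P|).
have {1}-> : 1%:M = L^T *m (L *m L^T) *m L by rewrite mulmxA LL mul1mx LL.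
exact: leq_trans (mxrankM_maxl _ _) (mxrankM_maxr _ _).
Qed.

Section Resolutions.
Variables (K : fieldType) (n : nat) (M : gbimod K n).
Local Notation E := (extalg K n).
Implicit Types F G : free_resolution M.

Lemma sum_mulmx (X : lmodType E) p q (x : 'rV[E]_p) (A : 'M[E]_(p, q)) (h : 'I_q -> X) :
  \sum_l (x *m A) 0 l *: h l = \sum_k x 0 k *: \sum_l A k l *: h l.
Proof.
under eq_bigr => l _ do rewrite mxE scaler_suml.
rewrite exchange_big; apply: eq_bigr => k _; rewrite scaler_sumr.
by apply: eq_bigr => l _; rewrite scalerA.
Qed.

Lemma res_diff_comp F i : res_diff F i.+1 *m res_diff F i = 0.
Proof.
apply/row_matrixP => k; rewrite row_mul row0; apply/res_exact.
by exists (delta_mx 0 k); rewrite -rowE.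
Qed.

Lemma res_diff_lift F i m (X : 'M[E]_(m, res_rank F i.+1)) : X *m res_diff F i = 0 ->
  exists Y, X = Y *m res_diff F i.+1.
Proof.
move=> X0; apply: lift_rows => k; apply/res_exact.
by rewrite -row_mul X0 row0.
Qed.

Lemma res_aug_lift F m (X : 'M[E]_(m, res_rank F 0)) :
  (forall k, \sum_l X k l *: res_aug (f := F) l = 0) -> exists Y, X = Y *m res_diff F 0.
Proof.
move=> X0; apply: lift_rows => k; apply/res_exact0.
by rewrite -[RHS](X0 k); apply: eq_bigr => l _; rewrite mxE.
Qed.

Variables (N : nat) (d : 'I_N -> int) (c : M -> 'rV[K]_N).
Hypothesis cP : graded_coordinates (@gb_deg K n M) d c.

Lemma augmentation_lift F G : exists a : 'M[E]_(res_rank F 0, res_rank G 0),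
  mx_deg (res_deg (f := F) (i := 0)) (res_deg (f := G) (i := 0)) a /\
  forall k, res_aug (f := F) k = \sum_l a k l *: res_aug (f := G) l.
Proof.
have /choice[x xP] k := res_aug_surj G (res_aug (f := F) k).
exists (mx_comp (res_deg (f := F) (i := 0)) (res_deg (f := G) (i := 0)) (\matrix_k x k)).
split=> [|k]; first exact: mx_comp_deg.
rewrite (xP k) (graded_sum_comp_id cP (e := res_deg (f := G) (i := 0)) (j := res_deg k)).
- by apply: eq_bigr => l _; rewrite !mxE.
- exact: res_aug_deg.
- by rewrite -xP; apply: res_aug_deg.
Qed.

Definition graded_map F G i (a : 'M[E]_(res_rank F i, res_rank G i)) :=
  mx_deg (res_deg (f := F) (i := i)) (res_deg (f := G) (i := i)) a.

Lemma graded_lift F G i (a : 'M[E]_(res_rank F i.+1, res_rank G i.+1)) : graded_map a ->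
  res_diff F i.+1 *m a *m res_diff G i = 0 ->
  exists2 a' : 'M[E]_(res_rank F i.+2, res_rank G i.+2),
    graded_map a' & res_diff F i.+1 *m a = a' *m res_diff G i.+1.
Proof.
move=> da /res_diff_lift[Y eY].
exists (mx_comp (res_deg (f := F) (i := i.+2)) (res_deg (f := G) (i := i.+2)) Y).
  exact: mx_comp_deg.
by apply: mx_comp_lift eY; [apply: mx_degM da; apply: res_diff_deg | apply: res_diff_deg].
Qed.

Lemma augmentation_lift1 F G (a : 'M[E]_(res_rank F 0, res_rank G 0)) : graded_map a ->
  (forall k, res_aug (f := F) k = \sum_l a k l *: res_aug (f := G) l) ->
  exists2 a' : 'M[E]_(res_rank F 1, res_rank G 1),
    graded_map a' & res_diff F 0 *m a = a' *m res_diff G 0.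
Proof.
move=> da aP; have [k|Y eY] := @res_aug_lift G _ (res_diff F 0 *m a).
  have := @sum_mulmx M _ _ (row k (res_diff F 0)) a (res_aug (f := G)).
  rewrite -row_mul; under eq_bigr => l _ do rewrite mxE.
  move=> ->; under eq_bigr => l _ do rewrite -aP.
  by apply/res_exact0; exists (delta_mx 0 k); rewrite rowE.
exists (mx_comp (res_deg (f := F) (i := 1)) (res_deg (f := G) (i := 1)) Y).
  exact: mx_comp_deg.
by apply: mx_comp_lift eY; [apply: mx_degM da; apply: res_diff_deg | apply: res_diff_deg].
Qed.

Lemma resolution_comparison F G i :
  homotopic_identity (res_diff F) (res_diff G) (@graded_map F G) (@graded_map G F) i.
Proof.
apply: comparison; [exact: res_diff_comp | exact: res_diff_comp | exact: res_diff_lift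
  | exact: graded_lift | exact: graded_lift |].
have [a [da aP]] := augmentation_lift F G; have [b [db bP]] := augmentation_lift G F.
have [a' da' ea] := augmentation_lift1 da aP; have [b' db' eb] := augmentation_lift1 db bP.
have abP k : \sum_l (a *m b) k l *: res_aug (f := F) l = res_aug (f := F) k.
  have := @sum_mulmx M _ _ (row k a) b (res_aug (f := F)); rewrite -row_mul => e.
  rewrite (aP k) (_ : \sum_l _ = \sum_l row k (a *m b) 0 l *: res_aug (f := F) l).
    by rewrite e; apply: eq_bigr => l _; rewrite mxE -bP.
  by apply: eq_bigr => l _; rewrite [in RHS]mxE.
have [k|h eh] := @res_aug_lift F _ (a *m b - 1%:M).
  rewrite (_ : \sum_l _ = \sum_l (a *m b) k l *: res_aug (f := F) l -
      \sum_l (k == l)%:R *: res_aug (f := F) l).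
    rewrite abP (bigD1 k) //= eqxx scale1r big1 ?addr0 ?subrr // => l lk.
    by rewrite eq_sym (negPf lk) scale0r.
  rewrite -sumrB; apply: eq_bigr => l _; rewrite -scalerBl; congr (_ *: _).
  by rewrite !mxE.
exists a, b, a', b', h, 0; split=> //.
  by rewrite addr0 -eh addrC subrK.
by rewrite mulmx0.
Qed.

Lemma tensor_degK F i j : tensor_deg F i j *m tensor_deg F i j = tensor_deg F i j.
Proof.
apply/matrixP => k l; rewrite mul_diag_mx !mxE.
by case: (res_deg k == j); rewrite /= ?mul1r ?mul0r ?mul0rn.
Qed.

Lemma sub_tensor_degP F i j (z : 'rV[K]_(res_rank F i)) :
  reflect (z *m tensor_deg F i j = z) (z <= tensor_deg F i j)%MS.
Proof.
apply: (iffP idP) => [/submxP[y ->]|<-]; last exact: submxMl.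
by rewrite -mulmxA tensor_degK.
Qed.

Lemma sub_cyclesP F i j (z : 'rV[K]_(res_rank F i)) : (z <= cycles F i j)%MS <->
  (z <= tensor_deg F i j)%MS /\
  match i return 'rV[K]_(res_rank F i) -> Prop with
  | 0 => fun _ => True | i'.+1 => fun z => z *m tensor_diff F i' = 0 end z.
Proof.
case: i z => [|i] z /=; first by split=> [|[]].
by rewrite sub_capmx; split=> [/andP[-> /sub_kermxP]|[-> /sub_kermxP]].
Qed.

Lemma tensor_diff_deg F i j :
  tensor_deg F i.+1 j *m tensor_diff F i = tensor_diff F i *m tensor_deg F i j.
Proof. by apply: mx_const_deg; apply: res_diff_deg. Qed.

Lemma boundaries_cycles F i j : (boundaries F i j <= cycles F i j)%MS.
Proof.
apply/rV_subP => _ /submxP[y ->]; apply/sub_cyclesP; split.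
  by rewrite /boundaries tensor_diff_deg mulmxA submxMl.
case: i y => // i y; rewrite /boundaries -!mulmxA -[tensor_diff F i.+1 *m _]mx_constM.
by rewrite res_diff_comp mx_const0 !mulmx0.
Qed.

Lemma homotopy_tail_cycles F G i j (a : 'M[E]_(res_rank F i, res_rank G i)) b X
    (z : 'rV[K]_(res_rank F i)) :
  graded_map a -> homotopy_tail (res_diff F) (res_diff G) a b X -> (z <= cycles F i j)%MS ->
  (z *m mx_const a <= cycles G i j)%MS /\ z *m mx_const X = 0.
Proof.
case: i a b X z => [|i] a b X z da /= => [->|[a0 [b0 [h [ea _ ->]]]]].
  move=> /sub_tensor_degP <-; rewrite mx_const0 mulmx0; split=> //.
  by rewrite -mulmxA (mx_const_deg j da) mulmxA submxMl.
rewrite !sub_capmx => /andP[/sub_tensor_degP zP /sub_kermxP zd].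
split; last by rewrite mx_constM mulmxA zd mul0mx.
apply/andP; split; first by rewrite -zP -mulmxA (mx_const_deg j da) mulmxA submxMl.
by apply/sub_kermxP; rewrite -mulmxA -[mx_const a *m _]mx_constM -ea mx_constM mulmxA zd mul0mx.
Qed.

(** The comparison map is injective on homology because composing it with its homotopy inverse
    changes cycles by boundaries only. Exchanging [F] and [G] gives independence of the
    resolution. *)
Lemma homology_dim_le F G i j : (homology_dim F i j <= homology_dim G i j)%N.
Proof.
have [a [b [a' [b' [h [X [[da _ _ db'] ea eb ab [_ tail]]]]]]]] := resolution_comparison F G i.
have Pb' : tensor_deg G i.+1 j *m mx_const b' = mx_const b' *m tensor_deg F i.+1 j.
  exact: mx_const_deg.
have cb : tensor_diff G i *m mx_const b = mx_const b' *m tensor_diff F i.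
  by rewrite -[LHS]mx_constM eb mx_constM.
have bnd y : (y *m boundaries G i j *m mx_const b *m tensor_deg F i j <= boundaries F i j)%MS.
  rewrite /boundaries -!mulmxA [tensor_diff G i *m _]mulmxA cb -[(_ *m tensor_diff F i) *m _]mulmxA.
  rewrite [tensor_deg G _ _ *m _]mulmxA Pb' -tensor_diff_deg.
  by rewrite mulmxA submxMl.
apply: (subquotient_rank_le (a := mx_const a)); first exact: boundaries_cycles.
  apply/rV_subP => _ /submxP[y ->]; rewrite mulmxA.
  exact: (homotopy_tail_cycles da tail (submxMl _ _)).1.
move=> z zc /submxP[y zaB]; have [_ zX] := homotopy_tail_cycles da tail zc.
have /sub_cyclesP[/sub_tensor_degP zP _] := zc.
have := congr1 (fun Y => z *m mx_const Y) ab.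
rewrite !mx_constD !mx_constM mx_const1 !mulmxDr zX addr0 mulmx1 mulmxA zaB => /esym/eqP.
(* The homotopy [h] is not known to be graded, so the identity is projected to degree [j] at this
   point. *)
rewrite eq_sym -subr_eq => /eqP ez; rewrite -zP -ez mulmxBl addmx_sub ?bnd // eqmx_opp.
by rewrite -!mulmxA -[mx_const (res_diff F i) *m _]tensor_diff_deg mulmxA submxMl.
Qed.

Lemma tor_dimE F i j : tor_dim M i j = homology_dim F i j.
Proof.
rewrite /tor_dim; case: xgetP => [_ -> [G ->]|/(_ (homology_dim F i j))]; last by case; exists F.
by apply/eqP; rewrite eqn_leq !homology_dim_le.
Qed.

(** Minimality makes all differentials of $K\otimes_E F$ vanish, so the homology is the whole
    component. *)
Lemma minimal_tor_dim F i j : (forall i k l, res_diff F i k l finset.set0 = 0) ->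
  tor_dim M i j = (\sum_(k < res_rank F i) (res_deg k == j))%N.
Proof.
move=> minF; rewrite (tor_dimE F).
have d0 m : tensor_diff F m = 0 by apply/matrixP => k l; rewrite mxE minF mxE.
have -> : homology_dim F i j = \rank (tensor_deg F i j).
  rewrite /homology_dim /boundaries d0 mulmx0 mxrank0 subn0.
  case: i => // i; apply/eqmx_rank/andP; split; apply/rV_subP => z; rewrite sub_capmx.
    by case/andP.
  by move=> ->; apply/sub_kermxP; rewrite d0 mulmx0.
by rewrite rank_diag_pred -sum1_card big_mkcond.
Qed.

Lemma minimal_betti F i : (forall i k l, res_diff F i k l finset.set0 = 0) ->
  betti M i = res_rank F i.
Proof.
move=> minF; rewrite /betti.
rewrite (eq_fsbigr (fun j => \sum_(k < res_rank F i) (res_deg k == j))%N); last first.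
  by move=> j _; apply: minimal_tor_dim.
rewrite (fsbigE (undup [seq res_deg k | k : 'I_(res_rank F i)])) ?undup_uniq //; last first.
  move=> j _; rewrite mem_undup => jF; apply: big1 => k _; apply/eqP; rewrite eqb0.
  by apply: contra jF => /eqP <-; rewrite map_f ?mem_enum.
rewrite (eq_bigl xpredT) => [|j]; last exact: in_setT.
rewrite exchange_big -[RHS]card_ord -sum1_card; apply: eq_bigr => k _.
have kF : res_deg k \in undup [seq res_deg k | k : 'I_(res_rank F i)].
  by rewrite mem_undup map_f ?mem_enum.
rewrite (bigD1_seq _ kF (undup_uniq _)) /= eqxx big1 // => j /negPf.
by rewrite eq_sym => ->.
Qed.

End Resolutions.

(** * Resolutions of tensor products *)

Section Universal.
Variables (K : fieldType) (n : nat).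
Local Notation E := (extalg K n).
Variables (X : lmodType E) (y : 'I_n -> X -> X).
Hypotheses (yl : forall i, klinear (y i)) (yy : forall i x, y i (y i x) = 0)
  (yC : forall i j x, y i (y j x) = - y j (y i x)).

Implicit Types S : {set 'I_n}.

Let y0 i : y i 0 = 0.
Proof. by apply: (addrI (y i 0)); rewrite -(yl i).1 !addr0. Qed.

Definition ordered_action (s : seq 'I_n) (S : {set 'I_n}) (x : X) : X :=
  foldr (fun j z => if j \in S then y j z else z) x s.

Lemma ordered_action_anticomm s S i x :
  y i (ordered_action s S x) = ((-1) ^+ count (mem S) s : K)%:A *: ordered_action s S (y i x).
Proof.
elim: s => [|j s IH] /=; first by rewrite !scale1r.
case: ifP => jS; rewrite ?add1n ?add0n; last by rewrite IH.
by rewrite yC IH (yl j).2 exprS mulN1r !scaleNr.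
Qed.

Lemma count_take_enum (i : 'I_n) S : count (mem S) (take i (enum 'I_n)) = inversions [set i] S.
Proof.
have u : uniq [seq j <- take i (enum 'I_n) | mem S j] by rewrite filter_uniq // take_uniq // enum_uniq.
rewrite -size_filter -(card_uniqP u) /inversions.
have inj : injective (fun j : 'I_n => (i, j)) by move=> j k [].
rewrite -(card_imset _ inj); apply: eq_card => -[i' j]; rewrite !inE /=.
apply/imsetP/idP => [[j']|/and3P[/eqP -> jS ji]].
  rewrite mem_filter => /andP[j'S]; rewrite in_take ?mem_enum // index_enum_ord => j'i [-> ->].
  by rewrite eqxx j'S.
by exists j => //; rewrite mem_filter /= jS in_take ?mem_enum // index_enum_ord.
Qed.

Lemma enum_ord_split (i : 'I_n) :
  enum 'I_n = take i (enum 'I_n) ++ i :: drop i.+1 (enum 'I_n).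
Proof.
rewrite -[LHS](cat_take_drop i) (drop_nth i) ?size_enum_ord //.
by rewrite nth_ord_enum.
Qed.

(** Mirrors [ext_genb]: [y i] passes the members of [S] preceding [i], which are those counted by
    the inversions, and then either meets itself or takes its place. *)
Lemma ordered_action_gen (i : 'I_n) S x : y i (ordered_action (enum 'I_n) S x) =
  if i \in S then 0
  else ((-1) ^+ inversions [set i] S : K)%:A *: ordered_action (enum 'I_n) (i |: S) x.
Proof.
have u := enum_uniq 'I_n; rewrite (enum_ord_split i) cat_uniq /= in u.
case/and3P: u => _ /norP[it _] /andP[id _].
have cat s1 s2 T z : ordered_action (s1 ++ s2) T z = ordered_action s1 T (ordered_action s2 T z).
  exact: foldr_cat.
have U1 s z : i \notin s -> ordered_action s (i |: S) z = ordered_action s S z.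
  elim: s => //= j s IH; rewrite inE negb_or => /andP[ij /IH ->].
  by rewrite !inE eq_sym (negPf ij).
have z0 s : ordered_action s S 0 = 0.
  by elim: s => //= j s ->; case: ifP => _; rewrite ?y0.
rewrite (enum_ord_split i) !cat ordered_action_anticomm count_take_enum /= !inE eqxx /=.
case: ifP => _; first by rewrite yy z0 scaler0.
by rewrite !U1.
Qed.

(** The universal property of $E$: square-zero anticommuting operators extend to an action, and this
    is $a\mapsto a\cdot x$ for it. *)
Definition ext_act (x : X) (a : E) : X :=
  \sum_(S : {set 'I_n}) (a S)%:A *: ordered_action (enum 'I_n) S x.

Lemma ext_actD x a b : ext_act x (a + b) = ext_act x a + ext_act x b.
Proof. by rewrite -big_split; apply: eq_bigr => S _; rewrite ffunE !scalerDl. Qed.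

Lemma ext_actZ x k a : ext_act x (k *: a) = k%:A *: ext_act x a.
Proof.
rewrite scaler_sumr; apply: eq_bigr => S _.
by rewrite ext_scaleE !scalerA -scalerAl mul1r scalerA.
Qed.

Lemma ext_act0 x : ext_act x 0 = 0.
Proof. by rewrite -[0](scale0r 0) ext_actZ !scale0r. Qed.

Lemma ext_act_basis x S : ext_act x (ext_basis K S) = ordered_action (enum 'I_n) S x.
Proof.
rewrite /ext_act (bigD1 S) //= ffunE eqxx !scale1r big1 ?addr0 // => T /negPf TS.
by rewrite ffunE TS !scale0r.
Qed.

Lemma ext_act1 x : ext_act x 1 = x.
Proof.
rewrite ext_act_basis; elim: (enum _) => //= j s ->.
by rewrite inE.
Qed.

Lemma ext_act_gen x i a : ext_act x (ext_gen K i * a) = y i (ext_act x a).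
Proof.
rewrite {1}(ext_decomp a) mulr_sumr (big_morph (ext_act x) (ext_actD x) (ext_act0 x)).
rewrite (big_morph (y i) (yl i).1 (y0 i)); apply: eq_bigr => S _.
rewrite -scalerAr ext_actZ (yl i).2 ext_genb ordered_action_gen; congr (_ *: _).
by case: ifP => _; rewrite ?ext_act0 // ext_actZ ext_act_basis.
Qed.

End Universal.

Section Twist.
Variables (K : fieldType) (n q : nat).
Local Notation E := (extalg K n).
Variables (P : 'M[K]_q) (L : 'I_n -> 'M[K]_q).
Hypotheses (PP : P *m P = 1%:M) (PL : forall i, P *m L i = - (L i *m P))
  (LL : forall i, L i *m L i = 0) (LC : forall i j, L i *m L j = - (L j *m L i)).

Definition cmx p r (B : 'M[K]_(p, r)) : 'M[E]_(p, r) := map_mx (in_alg E) B.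

Lemma cmxM p r t (B : 'M[K]_(p, r)) (B' : 'M[K]_(r, t)) : cmx (B *m B') = cmx B *m cmx B'.
Proof. exact: map_mxM. Qed.

Lemma cmxN p r (B : 'M[K]_(p, r)) : cmx (- B) = - cmx B.
Proof. exact: map_mxN. Qed.

Lemma scale_cmx p r t (a : E) (B : 'M[K]_(p, r)) (x : 'M[E]_(r, t)) :
  cmx B *m (a *: x) = a *: (cmx B *m x).
Proof.
apply/matrixP => k l; rewrite !mxE mulr_sumr; apply: eq_bigr => j _.
by rewrite !mxE mulrA -ext_algC mulrA.
Qed.

Variable r : nat.
Implicit Types x : 'M[E]_(q, r).

(* The diagonal action of [e_i] on [Q (x) E^r], where [P] is the parity of [Q]. *)
Definition twist (i : 'I_n) x : 'M[E]_(q, r) := cmx P *m (ext_gen K i *: x) + cmx (L i) *m x.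

Lemma twist_klinear i : klinear (twist i).
Proof.
split=> [x z|k x]; first by rewrite /twist scalerDr !mulmxDr addrACA.
by rewrite /twist !scale_cmx scalerDr !scalerA ext_algC.
Qed.

Lemma twistM i j x : twist i (twist j x) =
  (ext_gen K i * ext_gen K j) *: x + ext_gen K i *: (cmx (P *m L j) *m x) +
  (ext_gen K j *: (cmx (L i *m P) *m x) + cmx (L i *m L j) *m x).
Proof.
have tE k z : twist k z = ext_gen K k *: (cmx P *m z) + cmx (L k) *m z by rewrite /twist scale_cmx.
rewrite tE [twist j x]tE !mulmxDr !scale_cmx scalerDr scalerA !mulmxA -!cmxM PP.
rewrite /cmx map_mx1 mul1mx; congr (_ + _ + _).
Qed.

Lemma twist_sqr i x : twist i (twist i x) = 0.
Proof.
rewrite twistM ext_gen_sqr scale0r add0r LL PL cmxN mulNmx scalerN.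
by rewrite addrA addNr add0r /cmx map_mx0 mul0mx.
Qed.

Lemma twist_anticomm i j x : twist i (twist j x) = - twist j (twist i x).
Proof.
have LP k : L k *m P = - (P *m L k) by rewrite PL opprK.
have N (B : 'M[K]_q) : cmx (- B) *m x = - (cmx B *m x) by rewrite cmxN mulNmx.
rewrite !twistM (ext_gen_anticomm K i j) scaleNr (LP i) (LP j) (LC i j) !N.
move: (cmx (P *m L i) *m x) (cmx (P *m L j) *m x) (cmx (L j *m L i) *m x) => u v w.
rewrite (scalerN _ u) (scalerN _ v) !opprD opprK.
exact: addrACA.
Qed.

(** The $E$-linear map from the ordinary to the diagonal action that fixes the basis $Q\otimes K^r$;
    its bijectivity shows that the diagonal module is free. *)
Definition untwist x : 'M[E]_(q, r) :=
  \sum_k \sum_l ext_act twist (delta_mx k l) (x k l).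

Lemma untwistD x z : untwist (x + z) = untwist x + untwist z.
Proof.
rewrite -big_split; apply: eq_bigr => k _; rewrite -big_split; apply: eq_bigr => l _.
by rewrite mxE ext_actD.
Qed.

Lemma untwist_klinear : klinear untwist.
Proof.
split=> [x z|k x]; first exact: untwistD.
rewrite scaler_sumr; apply: eq_bigr => j _; rewrite scaler_sumr; apply: eq_bigr => l _.
by rewrite mxE mulr_algl ext_actZ.
Qed.

Lemma untwist_gen i x : untwist (ext_gen K i *: x) = twist i (untwist x).
Proof.
have [tD _] := twist_klinear i.
have t0 : twist i 0 = 0 by apply: (addrI (twist i 0)); rewrite -tD !addr0.
rewrite /untwist (big_morph (twist i) tD t0); apply: eq_bigr => k _.
rewrite (big_morph (twist i) tD t0); apply: eq_bigr => l _.
rewrite mxE; apply: ext_act_gen; [exact: twist_klinear | exact: twist_sqr | exact: twist_anticomm].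
Qed.

Lemma untwist_cmx (B : 'M[K]_(q, r)) : untwist (cmx B) = cmx B.
Proof.
rewrite [RHS]matrix_sum_delta; apply: eq_bigr => k _; apply: eq_bigr => l _.
by rewrite mxE ext_actZ ext_act1.
Qed.

Lemma untwist_surj x : exists z, untwist z = x.
Proof.
have U0 : untwist 0 = 0 by apply: (addrI (untwist 0)); rewrite -untwistD !addr0.
have imc (a : E) : forall B, exists z, untwist z = a *: cmx B.
  elim/ext_ind: a => [|a b ha hb|k a ha|i a ha] B.
  - by exists (cmx B); rewrite untwist_cmx scale1r.
  - have [z ez] := ha B; have [w ew] := hb B; exists (z + w).
    by rewrite untwistD ez ew scalerDl.
  - have [z ez] := ha B; exists (k%:A *: z).
    by rewrite untwist_klinear.2 ez scalerA mulr_algl.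
  (* From $P^2=1$, acting diagonally on $a\otimes PB$ yields $e_ia\otimes B$ plus $a\otimes L_iPB$;
     the second term is removed by induction. *)
  - have [z ez] := ha (P *m B); have [w ew] := ha (L i *m P *m B).
    exists (ext_gen K i *: z - w).
    have -> : untwist (ext_gen K i *: z - w) = untwist (ext_gen K i *: z) - untwist w.
      by apply/eqP; rewrite -(can2_eq (addrK _) (subrK _)) -untwistD subrK.
    rewrite untwist_gen ez ew /twist !scale_cmx -!cmxM scalerA mulmxA PP mul1mx mulmxA.
    by rewrite addrK.
have /choice[f fP] (t : 'I_q * 'I_r) : exists z, untwist z = x t.1 t.2 *: cmx (delta_mx t.1 t.2).
  exact: imc.
exists (\sum_t f t); rewrite (big_morph untwist untwistD U0).
rewrite [RHS]matrix_sum_delta [RHS]pair_bigA; apply: eq_bigr => t _ /=.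
by rewrite fP /cmx map_delta_mx.
Qed.

Lemma untwist_bij : bijective untwist.
Proof.
have [N [c [_ [cP _ _]]]] := matrix_coordinates K n q r.
have inj := klinear_surj_inj cP untwist_klinear untwist_surj.
have /choice[g gP] := untwist_surj.
by exists g => // x; apply: inj; rewrite gP.
Qed.

End Twist.

Section Resolves.
Variables (K : fieldType) (n : nat).
Local Notation E := (extalg K n).

(* [eps i] is the action of [e_i]: the module structure of [V] is only recorded on generators. *)
Definition resolves (V : lmodType K) (eps : 'I_n -> V -> V) (r : nat -> nat)
    (D : forall i, 'M[E]_(r i.+1, r i)) (aug : 'rV[E]_(r 0) -> V) : Prop :=
  [/\ {morph aug : x y / x + y} /\ (forall (k : K) x, aug (k%:A *: x) = k *: aug x),
      forall i x, aug (ext_gen K i *: x) = eps i (aug x),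
      forall v, exists x, aug x = v,
      forall x, aug x = 0 <-> exists y, x = y *m D 0%N
    & forall i (x : 'rV[E]_(r i.+1)), x *m D i = 0 <-> exists y, x = y *m D i.+1].

Lemma mul_rV_fun p q (T : 'rV[E]_p -> 'rV[E]_q) : {morph T : x y / x + y} ->
  (forall (k : K) x, T (k%:A *: x) = k%:A *: T x) ->
  (forall i x, T (ext_gen K i *: x) = ext_gen K i *: T x) ->
  forall x, T x = x *m \matrix_k T (delta_mx 0 k).
Proof.
move=> TD TZ Tg x; have T0 : T 0 = 0 by apply: (addrI (T 0)); rewrite -TD !addr0.
have TE a z : T (a *: z) = a *: T z.
  elim/ext_ind: a => [|a b IHa IHb|k a IH|i a IH]; first by rewrite !scale1r.
  - by rewrite !scalerDl TD IHa IHb.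
  - by rewrite -mulr_algl -!scalerA TZ IH.
  - by rewrite -!scalerA Tg IH.
rewrite {1}(row_sum_delta x) (big_morph T TD T0) mulmx_sum_row.
by apply: eq_bigr => k _; rewrite TE rowK.
Qed.

Section Tensor.
Variables (V : lmodType K) (eps : 'I_n -> V -> V) (r : nat -> nat).
Variables (D : forall i, 'M[E]_(r i.+1, r i)) (aug : 'rV[E]_(r 0) -> V).
Hypothesis DP : resolves eps D aug.
Variables (q : nat) (s : 'rV[K]_q) (L : 'I_n -> 'M[K]_q).
Hypotheses (PP : diag_mx s *m diag_mx s = 1%:M)
  (PL : forall i, diag_mx s *m L i = - (L i *m diag_mx s))
  (LL : forall i, L i *m L i = 0) (LC : forall i j, L i *m L j = - (L j *m L i)).

(** A family [w] stands for $\sum_l q_l\otimes w_l$ in $Q\otimes V$, with $e_i$ acting diagonally;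
    the sign [s 0 l] arises from moving $e_i$ past $q_l$. *)
Definition tensor_eps (i : 'I_n) (w : {ffun 'I_q -> V}) : {ffun 'I_q -> V} :=
  [ffun l => s 0 l *: eps i (w l) + \sum_k L i l k *: w k].

(** Applying [D] row by row is exact and commutes with the diagonal action, since [D] multiplies on
    the right and $P$, $L_i$ on the left. Conjugation with [untwist] turns this into a complex of
    ordinary free modules. *)
Lemma tensor_resolves : exists (D' : forall i, 'M[E]_(q * r i.+1, q * r i)) aug',
  resolves (r := fun i => (q * r i)%N) tensor_eps D' aug'.
Proof.
have [[augD augZ] auge augs ex0 exD] := DP.
have aug0 : aug 0 = 0 by apply: (addrI (aug 0)); rewrite -augD !addr0.
pose U m : 'M[E]_(q, m) -> 'M[E]_(q, m) := untwist (diag_mx s) L (r := m).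
have UP m : {g | cancel (@U m) g /\ cancel g (@U m)}.
  by apply: cid; have [g gK Kg] := untwist_bij PP PL LL LC m; exists g.
pose U' m := sval (UP m).
have UK m : cancel (@U m) (U' m) by apply: (svalP (UP m)).1.
have KU m : cancel (U' m) (@U m) by apply: (svalP (UP m)).2.
have UD m (x y : 'M[E]_(q, m)) : U m (x + y) = U m x + U m y by apply: untwistD.
have UZ m (k : K) (x : 'M[E]_(q, m)) : U m (k%:A *: x) = k%:A *: U m x.
  exact: (@untwist_klinear K n q (diag_mx s) L m).2.
have Ue m i (x : 'M[E]_(q, m)) : U m (ext_gen K i *: x) = twist (diag_mx s) L i (U m x).
  exact: untwist_gen.
have U0 m : U m 0 = 0 by apply: (addrI (U m 0)); rewrite -UD !addr0.
have U'D m (x y : 'M[E]_(q, m)) : U' m (x + y) = U' m x + U' m y.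
  by apply: (can_inj (UK m)); rewrite UD !KU.
have U'Z m (k : K) (x : 'M[E]_(q, m)) : U' m (k%:A *: x) = k%:A *: U' m x.
  by apply: (can_inj (UK m)); rewrite UZ !KU.
have U'e m i (x : 'M[E]_(q, m)) : U' m (twist (diag_mx s) L i x) = ext_gen K i *: U' m x.
  by apply: (can_inj (UK m)); rewrite Ue !KU.
pose T i (x : 'rV[E]_(q * r i.+1)) : 'rV[E]_(q * r i) :=
  mxvec (U' _ (U _ (vec_mx x) *m D i)).
pose D' i : 'M[E]_(q * r i.+1, q * r i) := \matrix_k T i (delta_mx 0 k).
have TE i x : x *m D' i = T i x.
  apply/esym/mul_rV_fun => [y z|k y|j y]; rewrite /T.
  - by rewrite !linearD /= UD mulmxDl U'D linearD.
  - by rewrite linearZ /= UZ -scalemxAl U'Z linearZ.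
  - rewrite linearZ /= Ue -linearZ -U'e; congr (mxvec (U' _ _)).
    by rewrite /twist mulmxDl -!mulmxA -scalemxAl.
pose aug' (x : 'rV[E]_(q * r 0)) : {ffun 'I_q -> V} := [ffun l => aug (row l (U _ (vec_mx x)))].
have lift_rows_iff m (X : 'M[E]_(q, r m.+1)) : X *m D m = 0 <-> exists Y, X = Y *m D m.+1.
  split=> [X0|[Y ->]]; last first.
    by apply/row_matrixP => k; rewrite row0 !row_mul; apply/exD; exists (row k Y).
  by apply: lift_rows => k; apply/exD; rewrite -row_mul X0 row0.
exists D', aug'; split.
- split=> [x y|k x]; apply/ffunP => l; rewrite !ffunE.
    by rewrite linearD /= UD linearD augD.
  by rewrite linearZ /= UZ linearZ augZ.
- move=> i x; apply/ffunP => l; rewrite !ffunE linearZ /= Ue.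
  have -> : row l (twist (diag_mx s) L i (U _ (vec_mx x))) =
      (s 0 l)%:A *: (ext_gen K i *: row l (U _ (vec_mx x))) +
      \sum_k (L i l k)%:A *: row k (U _ (vec_mx x)).
    rewrite /twist linearD /= /cmx map_diag_mx !row_mul row_diag_mx -scalemxAl -rowE mxE.
    by rewrite [row l (_ *: _)]linearZ mulmx_sum_row; congr (_ + _); apply: eq_bigr => k _; rewrite !mxE.
  rewrite augD augZ auge; congr (_ + _); rewrite (big_morph aug augD aug0).
  by apply: eq_bigr => k _; rewrite augZ ffunE.
- move=> w; have /choice[x xP] l := augs (w l).
  exists (mxvec (U' _ (\matrix_l x l))); apply/ffunP => l.
  by rewrite ffunE mxvecK KU rowK.
- move=> x; split=> [x0|[y ->]].
    have [l|Z eZ] := @lift_rows K n _ _ _ (D 0%N) (U _ (vec_mx x)).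
      by apply/ex0; have := congr1 (fun f : {ffun _ -> _} => f l) x0; rewrite !ffunE.
    by exists (mxvec (U' _ Z)); rewrite TE /T mxvecK KU -eZ UK vec_mxK.
  apply/ffunP => l; rewrite TE /T !ffunE mxvecK KU row_mul.
  by apply/ex0; eexists.
- move=> i x; rewrite TE /T; split=> [x0|[y ->]].
    have : U _ (vec_mx x) *m D i = 0.
      by rewrite -[LHS]KU -[U' _ _]mxvecK x0 linear0 U0.
    by case/lift_rows_iff=> Z eZ; exists (mxvec (U' _ Z)); rewrite TE /T mxvecK KU -eZ UK vec_mxK.
  rewrite TE /T mxvecK KU (_ : _ *m D i = 0); last by apply/lift_rows_iff; eexists.
  by rewrite -[X in U' _ X](U0 (r i)) UK linear0.
Qed.

End Tensor.

(** A lift is chosen on basis vectors and extended by [ext_ind]. Higher degrees are left to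
    [comparison]. *)
Lemma equivariant_lift (V V' : lmodType K) (eps : 'I_n -> V -> V) (eps' : 'I_n -> V' -> V') r r'
    (D : forall i, 'M[E]_(r i.+1, r i)) (D' : forall i, 'M[E]_(r' i.+1, r' i)) aug aug' (f : V -> V') :
  resolves eps D aug -> resolves eps' D' aug' -> {morph f : x y / x + y} ->
  (forall (k : K) v, f (k *: v) = k *: f v) -> (forall i v, f (eps i v) = eps' i (f v)) ->
  exists a : 'M[E]_(r 0%N, r' 0%N), forall x, aug' (x *m a) = f (aug x).
Proof.
move=> [[augD augZ] auge augs _ _] [[augD' augZ'] auge' augs' _ _] fD fZ fe.
have aug0 : aug 0 = 0 by apply: (addrI (aug 0)); rewrite -augD !addr0.
have aug0' : aug' 0 = 0 by apply: (addrI (aug' 0)); rewrite -augD' !addr0.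
have f0 : f 0 = 0 by apply: (addrI (f 0)); rewrite -fD !addr0.
have /choice[a aP] k := augs' (f (aug (delta_mx 0 k))).
exists (\matrix_k a k) => x; rewrite mulmx_sum_row {2}(row_sum_delta x).
rewrite (big_morph aug' augD' aug0') (big_morph aug augD aug0) (big_morph f fD f0).
apply: eq_bigr => k _; rewrite rowK.
elim/ext_ind: (x 0 k) => [|b c IHb IHc|l b IH|i b IH]; first by rewrite !scale1r.
- by rewrite !scalerDl augD' augD fD IHb IHc.
- by rewrite -mulr_algl -!scalerA augZ' augZ fZ IH.
- by rewrite -!scalerA auge' auge fe IH.
Qed.

(* The lifted maps compose to the identity up to homotopy, and the homotopy terms vanish modulo
   the augmentation ideal because the first complex is minimal. *)
Lemma retract_rank_le (V V' : lmodType K) (eps : 'I_n -> V -> V) (eps' : 'I_n -> V' -> V') r r'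
    (D : forall i, 'M[E]_(r i.+1, r i)) (D' : forall i, 'M[E]_(r' i.+1, r' i)) aug aug'
    (f : V -> V') (g : V' -> V) :
  resolves eps D aug -> resolves eps' D' aug' ->
  {morph f : x y / x + y} -> (forall (k : K) v, f (k *: v) = k *: f v) ->
  (forall i v, f (eps i v) = eps' i (f v)) ->
  {morph g : x y / x + y} -> (forall (k : K) v, g (k *: v) = k *: g v) ->
  (forall i v, g (eps' i v) = eps i (g v)) -> cancel f g ->
  (forall i, mx_const (D i) = 0) -> forall i, (r i <= r' i)%N.
Proof.
move=> R R' fD fZ fe gD gZ ge fK minD i.
have [a0 a0P] := equivariant_lift R R' fD fZ fe; have [b0 b0P] := equivariant_lift R' R gD gZ ge.
have [[augD augZ] _ _ ex0 exD] := R; have [[augD' augZ'] _ _ ex0' exD'] := R'.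
have f0 : f 0 = 0 by apply: (addrI (f 0)); rewrite -fD !addr0.
have g0 : g 0 = 0 by apply: (addrI (g 0)); rewrite -gD !addr0.
have lift m p q t (A : 'M[E]_(p, q)) (B : 'M[E]_(q, t)) (X : 'M[E]_(m, q)) :
    (forall x : 'rV_q, x *m B = 0 <-> exists y, x = y *m A) -> X *m B = 0 -> exists Y, X = Y *m A.
  by move=> AB XB; apply: lift_rows => k; apply/AB; rewrite -row_mul XB row0.
have comp p q t (A : 'M[E]_(p, q)) (B : 'M[E]_(q, t)) :
    (forall x : 'rV_q, x *m B = 0 <-> exists y, x = y *m A) -> A *m B = 0.
  by move=> AB; apply/row_matrixP => k; rewrite row_mul row0; apply/AB; exists (delta_mx 0 k); rewrite -rowE.
have [a1 ea] : exists a1, D 0%N *m a0 = a1 *m D' 0%N.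
  apply: lift_rows => k; apply/ex0'; rewrite row_mul a0P (iffRL (ex0 _)) //.
  by exists (delta_mx 0 k); rewrite rowE.
have [b1 eb] : exists b1, D' 0%N *m b0 = b1 *m D 0%N.
  apply: lift_rows => k; apply/ex0; rewrite row_mul b0P (iffRL (ex0' _)) //.
  by exists (delta_mx 0 k); rewrite rowE.
have [h eh] : exists h, a0 *m b0 - 1%:M = h *m D 0%N.
  apply: lift_rows => k; apply/ex0; apply: (addrI (aug (row k 1%:M))).
  rewrite -augD addr0 [row k (_ - _)]linearB /= addrC subrK row_mul.
  by rewrite b0P [row k a0]rowE a0P fK row1.
(* Ranks do not involve the grading, so the predicates are trivial. *)
have base : homotopic_identity D D' (fun _ _ => True) (fun _ _ => True) 0.
  exists a0, b0, a1, b1, h, 0; split=> //; first by rewrite addr0 -eh addrC subrK.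
  by rewrite mulmx0.
have [j|j|j m X|j a _|j b _|a [b [a' [b' [h' [X [_ _ _ ab [_ tail]]]]]]]] := comparison _ _ _ _ _ base i.
- exact: comp (exD j).
- exact: comp (exD' j).
- exact: lift (exD j).
- by move=> /(lift _ _ _ _ _ _ _ (exD' j))[Y eY]; exists Y.
- by move=> /(lift _ _ _ _ _ _ _ (exD j))[Y eY]; exists Y.
have X0 : mx_const X = 0.
  case: i a b X tail {a' b' h' ab} => [|i] a b X /= => [->|[c0 [d0 [h0 [_ _ ->]]]]].
    exact: mx_const0.
  by rewrite mx_constM minD mul0mx.
have := congr1 (@mx_const K n _ _) ab.
(* Over $K$ the identity of size [r i] factors through size [r' i]. *)
rewrite !mx_constD !mx_constM mx_const1 X0 minD mulmx0 !addr0 => ab1.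
by rewrite -[X in (X <= _)%N](mxrank1 K (r i)) -ab1 mulmx_max_rank.
Qed.

End Resolves.

(** * The dual as a direct summand *)

Section DualRetract.
Variables (K : fieldType) (n N : nat) (A : 'I_n -> 'M[K]_N) (p : 'I_N -> bool).
Hypotheses (AA : forall i, A i *m A i = 0) (AC : forall i j, A i *m A j = - (A j *m A i))
  (Ap : forall i a b, A i a b != 0 -> p a != p b).

Let s : 'rV[K]_N := \row_a (-1) ^+ p a.
Let S : 'M[K]_N := diag_mx s.
(** The dual acts on row vectors by $A_i^TS$; [tensor_eps] multiplies from the left, which
    transposes this to $SA_i$. *)
Let L i : 'M[K]_N := S *m A i.
Let sgn (a b : 'I_N) : K := (-1) ^+ (p a && p b).

Lemma twist_SS : S *m S = 1%:M.
Proof.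
apply/matrixP => a b; rewrite mul_diag_mx !mxE; case: (a == b); last by rewrite mulr0.
by rewrite -expr2 sqrr_sign.
Qed.

Lemma twist_SA i : S *m A i = - (A i *m S).
Proof.
apply/matrixP => a b; rewrite mul_diag_mx mul_mx_diag !mxE.
have [->|/Ap] := eqVneq (A i a b) 0; first by rewrite mulr0 mul0r oppr0.
by case: (p a) (p b) => -[] //= _; rewrite ?expr0 ?expr1 ?mul1r ?mulr1 ?mulN1r ?mulrN1 ?opprK.
Qed.

Lemma twist_AS i : A i *m S = - (S *m A i). Proof. by rewrite twist_SA opprK. Qed.

Lemma twist_SL i : S *m L i = - (L i *m S).
Proof. by rewrite /L mulmxA twist_SS mul1mx -mulmxA twist_AS mulmxN mulmxA twist_SS mul1mx opprK. Qed.

Lemma twist_LC i j : L i *m L j = - (L j *m L i).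
Proof.
rewrite /L ![S *m A _ *m (S *m _)]mulmxA -![S *m A _ *m S]mulmxA !twist_AS !mulmxN !mulmxA twist_SS !mul1mx.
by rewrite !mulNmx AC opprK.
Qed.

Lemma twist_LL i : L i *m L i = 0.
Proof.
by rewrite /L mulmxA -[S *m A i *m S]mulmxA twist_AS mulmxN mulmxA twist_SS mul1mx mulNmx AA oppr0.
Qed.

Let eps0 (i : 'I_n) (v : 'rV[K]_N) := v *m A i.
Let eps1 := tensor_eps eps0 s L.
Let eps2 := tensor_eps eps1 s L.

(* In [N (x) N (x) M] with [N] dual to [M], [dual_embed] tensors with the invariant element of
   [N (x) M], and [dual_retract] contracts the first factor with the last; the sign [sgn] comes
   from moving the last factor past the middle one. *)
Definition dual_embed (f : 'rV[K]_N) : {ffun 'I_N -> {ffun 'I_N -> 'rV[K]_N}} :=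
  [ffun a => [ffun b => (f 0 a * s 0 b) *: delta_mx 0 b]].

Definition dual_retract (w : {ffun 'I_N -> {ffun 'I_N -> 'rV[K]_N}}) : 'rV[K]_N :=
  \row_b \sum_a sgn a b * w a b 0 a.

Lemma dual_embedK : cancel dual_embed dual_retract.
Proof.
move=> f; apply/rowP => b; rewrite mxE (bigD1 b) //= big1 ?addr0 => [|a ab]; last first.
  by rewrite !ffunE !mxE (negPf ab) !mulr0.
rewrite !ffunE !mxE !eqxx mulr1 /sgn andbb mulrCA -expr2 sqrr_sign mulr1 //.
Qed.

Lemma dual_epsE i w a b c : eps2 i w a b 0 c =
  s 0 a * (s 0 b * (\sum_e w a b 0 e * A i e c) + \sum_k s 0 b * A i b k * w a k 0 c) +
  \sum_k s 0 a * A i a k * w k b 0 c.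
Proof.
have scaleE (V : lmodType K) (I : finType) (k : K) (f : {ffun I -> V}) x : (k *: f) x = k *: f x.
  by rewrite ffunE.
have LE x y : L i x y = s 0 x * A i x y by rewrite /L /S mul_diag_mx mxE.
rewrite /eps2 ffunE ffunE scaleE /eps1 ffunE sum_ffunE !mxE !summxE.
congr (_ * (_ * _ + _) + _); apply: eq_bigr => k _.
  by rewrite mxE LE [s 0 b]mxE.
by rewrite scaleE mxE LE [s 0 a]mxE.
Qed.

(** A generator changes parity, so the two signs are opposite wherever the entry is non-zero. This
    is the invariance of the element used in [dual_embed]. *)
Lemma sign_sum_eq0 i b c : A i b c * (1 + s 0 b * s 0 c) = 0.
Proof.
have [->|/Ap] := eqVneq (A i b c) 0; first by rewrite mul0r.
by rewrite !mxE; case: (p b) (p c) => -[] //= _; rewrite ?expr0 ?expr1 ?mul1r ?mulr1 subrr mulr0.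
Qed.

(** The actions on the second and third factors cancel by invariance, leaving the action on [f]. *)
Lemma dual_embed_eps i f : dual_embed (f *m (A i)^T *m S) = eps2 i (dual_embed f).
Proof.
apply/ffunP => a; apply/ffunP => b; apply/rowP => c; rewrite dual_epsE.
have wE g a' b' c' : dual_embed g a' b' 0 c' = g 0 a' * s 0 b' * (c' == b')%:R.
  by rewrite !ffunE mxE [delta_mx _ _ _ _]mxE eqxx.
have sum1 (F : 'I_N -> K) e : \sum_k F k * (k == e)%:R = F e.
  rewrite (bigD1 e) //= eqxx mulr1 big1 ?addr0 // => k /negPf ->.
  by rewrite mulr0.
have -> : \sum_e dual_embed f a b 0 e * A i e c = f 0 a * s 0 b * A i b c.
  rewrite -[RHS](sum1 (fun e => f 0 a * s 0 b * A i e c)); apply: eq_bigr => e _.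
  by rewrite wE mulrAC.
have -> : \sum_k s 0 b * A i b k * dual_embed f a k 0 c = s 0 b * A i b c * (f 0 a * s 0 c).
  rewrite -[RHS](sum1 (fun k => s 0 b * A i b k * (f 0 a * s 0 k))); apply: eq_bigr => k _.
  by rewrite wE !mulrA [c == k]eq_sym.
have -> : s 0 b * (f 0 a * s 0 b * A i b c) + s 0 b * A i b c * (f 0 a * s 0 c) =
    s 0 b * f 0 a * s 0 b * (A i b c * (1 + s 0 b * s 0 c)).
  have sb : s 0 b * s 0 b = 1 by rewrite mxE -expr2 sqrr_sign.
  have -> : s 0 b * f 0 a * s 0 b = f 0 a by rewrite mulrAC sb mul1r.
  rewrite (_ : s 0 b * (f 0 a * s 0 b * A i b c) = s 0 b * s 0 b * (f 0 a * A i b c)); last by ring.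
  by rewrite sb; ring.
rewrite sign_sum_eq0 !mulr0 add0r wE mul_mx_diag mxE mxE !mulr_suml.
by apply: eq_bigr => k _; rewrite wE [in LHS]mxE; ring.
Qed.

Lemma dual_retract_eps i w : dual_retract (eps2 i w) = dual_retract w *m (A i)^T *m S.
Proof.
apply/rowP => b.
have -> : (dual_retract w *m (A i)^T *m S) 0 b =
    \sum_a \sum_k sgn a b * s 0 a * s 0 b * A i b k * w a k 0 a.
  rewrite mul_mx_diag mxE mxE exchange_big mulr_suml; apply: eq_bigr => k _.
  rewrite [(A i)^T k b]mxE [dual_retract w 0 k]mxE !mulr_suml; apply: eq_bigr => a _.
  have [->|/Ap] := eqVneq (A i b k) 0; first by rewrite !(mulr0, mul0r).
  rewrite /sgn [s 0 a]mxE.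
  by case: (p a) (p b) (p k) => -[] [] //= _; ring.
(* The terms acting on the two contracted factors cancel in pairs once the summation indices are
   exchanged; only the action on the middle factor survives. *)
have zero : \sum_a \sum_c sgn a b * s 0 a * s 0 b * A i c a * w a b 0 c +
    \sum_a \sum_k sgn a b * s 0 a * A i a k * w k b 0 a = 0.
  rewrite [X in _ + X]exchange_big -big_split big1 //= => a _; rewrite -big_split big1 //= => c _.
  have -> : sgn a b * s 0 a * s 0 b * A i c a * w a b 0 c + sgn c b * s 0 c * A i c a * w a b 0 c
     = (A i c a * (sgn a b * s 0 a * s 0 b + sgn c b * s 0 c)) * w a b 0 c by ring.
  have [->|/Ap] := eqVneq (A i c a) 0; first by rewrite !mul0r.
  rewrite !mxE /sgn.
  by case: (p a) (p b) (p c) => -[] [] //= _; ring.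
rewrite -[RHS]addr0 -[X in _ = _ + X]zero addrCA mxE -!big_split; apply: eq_bigr => a _ /=.
rewrite dual_epsE !mulrDr -!addrA !mulr_sumr; congr (_ + (_ + _)).
- by apply: eq_bigr => k _; ring.
- by apply: eq_bigr => k _; ring.
- by apply: eq_bigr => k _; ring.
Qed.

End DualRetract.

Section DualBetti.
Variables (K : fieldType) (n : nat).
Local Notation E := (extalg K n).

Lemma resolution_resolves (M : gbimod K n) N (c : M -> 'rV[K]_N) (A : 'I_n -> 'M[K]_N)
    (F : free_resolution M) : coordinates c -> (forall i x, c (ext_gen K i *: x) = c x *m A i) ->
  resolves (fun i v => v *m A i) (res_diff F) (fun x => c (\sum_k x 0 k *: res_aug (f := F) k)).
Proof.
move=> cP cA; split.
- split=> [x y|k x].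
    rewrite -(coordD cP) -big_split; congr c; apply: eq_bigr => k _.
    by rewrite mxE scalerDl.
  rewrite -(coordZ cP) scaler_sumr; congr c; apply: eq_bigr => l _.
  by rewrite mxE scalerA.
- move=> i x; rewrite -cA scaler_sumr; congr c; apply: eq_bigr => l _.
  by rewrite mxE scalerA.
- move=> v; have [m <-] := coord_surj cP v; have [x ->] := res_aug_surj F m.
  by exists x.
- move=> x; split=> [/eqP|/res_exact0 ->]; last exact: coord0 cP.
  by rewrite (coord_eq0 cP) => /eqP /res_exact0.
- exact: res_exact.
Qed.

(** Stated for any two modules with transposed matrices, so that it applies in both directions. Each
    tensoring with the dual contributes a factor [N]. *)
Lemma minimal_rank_dual_le (M M' : gbimod K n) N (c : M -> 'rV[K]_N) (c' : M' -> 'rV[K]_N)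
    (A : 'I_n -> 'M[K]_N) (p : 'I_N -> bool) (F : free_resolution M) (F' : free_resolution M') i :
  coordinates c -> coordinates c' -> (forall i x, c (ext_gen K i *: x) = c x *m A i) ->
  (forall i x, c' (ext_gen K i *: x) = c' x *m ((A i)^T *m diag_mx (\row_a (-1) ^+ p a))) ->
  (forall i, A i *m A i = 0) -> (forall i j, A i *m A j = - (A j *m A i)) ->
  (forall i a b, A i a b != 0 -> p a != p b) ->
  (forall i k l, res_diff F' i k l finset.set0 = 0) ->
  (res_rank F' i <= N * (N * res_rank F i))%N.
Proof.
move=> cP cP' cA cA' AA AC Ap minF'.
have R0 := resolution_resolves F cP cA; have R' := resolution_resolves F' cP' cA'.
have [D1 [aug1 R1]] := tensor_resolves R0 (twist_SS K p) (twist_SL Ap) (twist_LL AA Ap) (twist_LC AC Ap).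
have [D2 [aug2 R2]] := tensor_resolves R1 (twist_SS K p) (twist_SL Ap) (twist_LL AA Ap) (twist_LC AC Ap).
apply: (retract_rank_le R' R2 (f := dual_embed p) (g := dual_retract p)).
- by move=> x y; apply/ffunP => a; apply/ffunP => b; rewrite !ffunE mxE mulrDl scalerDl.
- by move=> k x; apply/ffunP => a; apply/ffunP => b; rewrite !ffunE mxE scalerA mulrA.
- by move=> j v; rewrite mulmxA; apply: dual_embed_eps.
- move=> x y; apply/rowP => b; rewrite !mxE -big_split; apply: eq_bigr => a _.
  by rewrite !ffunE mxE mulrDr.
- move=> k x; apply/rowP => b; rewrite !mxE big_distrr; apply: eq_bigr => a _.
  by rewrite !ffunE mxE mulrCA.
- by move=> j v; rewrite mulmxA; apply: dual_retract_eps.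
- exact: dual_embedK.
- by move=> j; apply/matrixP => k l; rewrite !mxE minF'.
Qed.

End DualBetti.

(* Up to sign and a power of the invertible [S], the left side is the transpose of the right
   side, since the factors anticommute. *)
Lemma rank_prod_tr_sign (K : fieldType) N (S : 'M[K]_N) (s : seq 'M[K]_N) :
  S *m S = 1%:M -> anticommuting s -> (forall X, X \in s -> S *m X = - (X *m S)) -> S^T = S ->
  \rank (\prod_(X <- s) (X^T *m S)) = \rank (\prod_(X <- s) X).
Proof.
move=> SS ac SX St.
have [e e0 ->] : exists2 e : K, e != 0 &
    \prod_(X <- s) (X^T *m S) = e *: ((\prod_(X <- s) X)^T *m S ^+ size s).
  elim/last_ind: s ac SX => [|s X IH] ac SX.
    by exists 1; rewrite ?oner_eq0 // !big_nil scale1r trmx1 mulmx1.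
  have Xs : X \in rcons s X by rewrite mem_rcons inE eqxx.
  have [|e e0 IHe] := IH (anticommuting_rcons ac).
    by move=> Y Ys; apply: SX; rewrite mem_rcons inE Ys orbT.
  have SXt : S *m X^T = - (X^T *m S).
    have trN (Y : 'M[K]_N) : (- Y)^T = - Y^T by apply/matrixP => a b; rewrite !mxE.
    by rewrite -[S in LHS]St -trmx_mul -[X *m S]opprK -(SX _ Xs) trN trmx_mul St.
  have SkX k : S ^+ k *m X^T = (-1) ^+ k *: (X^T *m S ^+ k).
    elim: k => [|k IHk]; first by rewrite !expr0 mul1mx mulmx1 scale1r.
    rewrite exprSr -[_ * S]/(S ^+ k *m S) -mulmxA SXt mulmxN [_ *m (X^T *m S)]mulmxA IHk -scalemxAl -mulmxA.
    by rewrite exprS mulN1r scaleNr.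
  rewrite -cats1 !big_cat !big_seq1 /= IHe.
  have WX : (\prod_(Y <- s) Y) *m X = (-1) ^+ size s *: (X *m \prod_(Y <- s) Y).
    by apply: prod_anticomm => Y Ys; apply: (proj1 ac) => //; rewrite mem_rcons inE Ys orbT.
  exists e => //; rewrite -[_ * (X^T *m S)]/(_ *m (X^T *m S)) -scalemxAl; congr (_ *: _).
  rewrite -[_ * X]/(_ *m X) WX linearZ /= trmx_mul -scalemxAl -!mulmxA [S ^+ _ *m _]mulmxA SkX.
  by rewrite -scalemxAl -scalemxAr -mulmxA size_cat addn1 exprSr.
have Sk : S ^+ size s *m S ^+ size s = 1%:M.
  rewrite -[LHS]/(_ * _) -exprD addnn -mul2n exprM expr2 [S * S]SS.
  exact: expr1n.
rewrite (eqmx_scale _ e0) mxrankMfree ?mxrank_tr // row_free_unit.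
by case: (mulmx1_unit Sk).
Qed.

Lemma absz_odd_succ (x : int) : odd `|(1 + x)%R|%N != odd `|x|%N.
Proof.
case: x => m; first by rewrite -PoszD add1n /=; case: (odd m).
have -> : 1 + Negz m = - m%:Z by rewrite NegzE -[m.+1]addn1 PoszD opprD addrCA subrr addr0.
by rewrite abszN /=; case: (odd m).
Qed.

(** * Comparison of $M$ with its dual *)

Section Main.
Variables (K : fieldType) (n : nat) (M : gbimod K n).
Local Notation E := (extalg K n).
Hypotheses (M_in_catM : catM M) (M_neq0 : exists m : M, m != 0).

Lemma regular_seq_dual (s : seq E) : regular_seq M s <-> regular_seq (Edual M) s.
Proof.
have [N [d [c cP]]] := catM_coordinates M_in_catM.
have [c' [[cP' _ _] cA']] := dual_coordinates M_in_catM cP.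
have [coordsP degP degM] := cP.
have [A AP] := action_mx coordsP; have [A' AP'] := action_mx cP'.
have N0 : (0 < N)%N.
  have [m m0] := M_neq0; rewrite lt0n; apply: contraNneq m0 => N0.
  rewrite -(coord_eq0 coordsP); apply/eqP/rowP => i; have := ltn_ord i.
  by rewrite [X in (_ < X)%N]N0.
pose S : 'M[K]_N := degree_sign K d.
have SS : S *m S = 1%:M.
  apply/matrixP => a b; rewrite mul_diag_mx !mxE; case: (a == b); last by rewrite mulr0.
  by rewrite -expr2 sqrr_sign.
have St : S^T = S by apply: tr_diag_mx.
have [u [cu _]] := coord_basis coordsP.
have Adeg v a b : ext_deg 1 v -> A v a b != 0 -> d b = 1 + d a.
  move=> dv; have ua : gb_deg (d a) (u a).
    by apply/degP => e; rewrite cu mxE eqxx /=; have [->//|_] := eqVneq e a; rewrite eqxx.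
  have /degP/(_ b) := degM _ _ _ _ dv ua.
  by rewrite AP cu -rowE mxE.
(* A linear form raises degrees by one, hence anticommutes with the parity operator [S]. *)
have SA v : ext_deg 1 v -> S *m A v = - (A v *m S).
  move=> dv; apply/matrixP => a b; rewrite mul_diag_mx mul_mx_diag !mxE.
  have [->|/(Adeg _ _ _ dv) ->] := eqVneq (A v a b) 0; first by rewrite mulr0 mul0r oppr0.
  rewrite -[in LHS]signr_odd -[in RHS]signr_odd; have := absz_odd_succ (d a).
  by case: odd; case: odd => //= _; ring.
rewrite (regular_seqP coordsP AP _ N0) (regular_seqP cP' AP' _ N0).
suff e : (forall v, v \in s -> ext_deg 1 v) ->
    \rank (\prod_(Y <- map A' s) Y) = \rank (\prod_(Y <- map A s) Y).
  by split=> -[ds]; rewrite (e ds).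
move=> ds; have ac := action_mx_anticommuting coordsP AP ds.
rewrite -(rank_prod_tr_sign SS ac _ St) => [|_ /mapP[v vs ->]]; last exact: SA (ds _ vs).
congr (\rank _); rewrite !big_map big_seq [RHS]big_seq; apply: eq_bigr => v vs.
by apply: (action_mx_eq cP') => f; rewrite -AP' (cA' v (A v) (ds _ vs) (AP v)).
Qed.

Lemma regular_seq_dualE : @regular_seq K n M = @regular_seq K n (Edual M).
Proof. by apply/funext => s; apply/propext; apply: regular_seq_dual. Qed.

Lemma betti_dual_le : exists q, forall i,
  (betti M i <= q * betti (Edual M) i)%N /\ (betti (Edual M) i <= q * betti M i)%N.
Proof.
have [N [d [c cP]]] := catM_coordinates M_in_catM.
have [c' [cP' cA']] := dual_coordinates M_in_catM cP.
have [coordsP degP degM] := cP; have [coordsP' _ _] := cP'.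
have [F minF] := minimal_resolution cP; have [F' minF'] := minimal_resolution cP'.
exists (N * N)%N => i; rewrite (minimal_betti cP i minF) (minimal_betti cP' i minF').
rewrite -!mulnA.
have [B BP] := action_mx coordsP; pose A i := B (ext_gen K i).
have AP j x : c (ext_gen K j *: x) = c x *m A j by apply: BP.
pose p a := odd `|d a|%N.
have SE : degree_sign K d = diag_mx (\row_a (-1) ^+ p a).
  by congr diag_mx; apply/rowP => a; rewrite !mxE signr_odd.
have AP' j f : c' (ext_gen K j *: f) = c' f *m ((A j)^T *m diag_mx (\row_a (-1) ^+ p a)).
  by rewrite -SE; apply: cA' => //; apply: ext_deg_gen.
have AA j : A j *m A j = 0.
  by rewrite -(action_mxM coordsP BP) ext_gen_sqr (action_mx0 coordsP BP).
have AC j k : A j *m A k = - (A k *m A j).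
  by rewrite -!(action_mxM coordsP BP) -(action_mxN coordsP BP) ext_gen_anticomm.
have [u [cu _]] := coord_basis coordsP.
have Ap j a b : A j a b != 0 -> p a != p b.
  have ua : gb_deg (d a) (u a).
    by apply/degP => e; rewrite cu mxE eqxx /=; have [->//|_] := eqVneq e a; rewrite eqxx.
  have /degP/(_ b) := degM _ _ _ _ (@ext_deg_gen K n j) ua.
  rewrite AP cu -rowE mxE => h /h; rewrite /p => ->.
  by rewrite eq_sym absz_odd_succ.
split; last exact: (minimal_rank_dual_le F i coordsP coordsP' AP AP' AA AC Ap minF').
(* Dualizing twice turns $A_j$ into $(A_j^TS)^TS=SA_jS$, so the coordinates of $M$ are changed by
   [S] before the roles are exchanged. *)
pose S : 'M[K]_N := diag_mx (\row_a (-1) ^+ p a).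
have SS : S *m S = 1%:M by apply: twist_SS.
have St : S^T = S by apply: tr_diag_mx.
have cSP : coordinates (fun x => c x *m S).
  split=> [|x y|k x]; last 2 first.
  - by rewrite /= (coordD coordsP) mulmxDl.
  - by rewrite /= (coordZ coordsP) scalemxAl.
  have [[ci cK Kc] _ _] := coordsP; exists (fun w => ci (w *m S)) => [x|w].
    by rewrite -mulmxA SS mulmx1.
  by rewrite Kc -mulmxA SS mulmx1.
have BT j : (A j)^T *m S = (S *m A j)^T by rewrite trmx_mul St.
apply: (minimal_rank_dual_le (p := p) F' i coordsP' cSP AP' _ _ _ _ minF).
- move=> j x; rewrite AP BT trmxK -/S -!mulmxA; congr (_ *m _).
  by rewrite !mulmxA SS mul1mx.
- by move=> j; rewrite !BT -trmx_mul (twist_LL AA Ap) trmx0.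
- move=> j k; rewrite !BT -!trmx_mul (twist_LC AC Ap).
  by apply/matrixP => a b; rewrite !mxE.
- move=> j a b; rewrite mul_mx_diag !mxE mulf_eq0 negb_or => /andP[/Ap].
  by rewrite eq_sym.
Qed.

End Main.

(** The factor [q] is absorbed into [alpha], so every exponent admissible for [M'] is admissible for
    [M]. *)
Lemma complexity_le (R : realType) (K : fieldType) (n : nat) (M M' : gbimod K n) q :
  (forall i, (betti M i <= q * betti M' i)%N) ->
  (complexity R M <= complexity R M')%E.
Proof.
move=> le; apply: ereal.le_ereal_inf => _ [c [alpha h] <-]; exists c => //.
exists (q%:R * alpha) => i i1; apply: le_trans (_ : (q * betti M' i)%:R <= _).
  by rewrite ler_nat.
by rewrite natrM -mulrA ler_wpM2l ?ler0n // h.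
Qed.

Theorem theorem4p3 (R : realType) (K : fieldType) (n : nat) (M : gbimod K n)
    (M_in_catM : catM M) (M_neq0 : exists m : M, m != 0) :
  [/\ forall s : seq (extalg K n), regular_seq M s <-> regular_seq (Edual M) s,
      depth M = depth (Edual M)
    & complexity R M = complexity R (Edual M)].
Proof.
split.
- exact: regular_seq_dual.
(* [depth] depends only on the predicate [regular_seq], also when its value is [None]. *)
- by rewrite /depth /common_length /maximal_regular_seq (regular_seq_dualE M_in_catM M_neq0).
have [q le] := betti_dual_le M_in_catM.
by apply/eqP; rewrite eq_le !(@complexity_le _ _ _ _ _ q) // => i; have [] := le i.
Qed.
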